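(* Let $r\le s\le t$ be positive integers such that $K_{r,s,t}$ is decomposable into $5$-cycles. Let $p$ be a positive integer that is a multiple of $5$, with $p\equiv r \pmod 2$ and $\frac{t}{2}\le p\le 3r$. Then for every positive integer $n$, the graph $K_{r+np,\,s+np,\,t+np}$ has a decomposition into $5$-cycles.
   Context: $K_{r,s,t}$ denotes the complete tripartite graph with parts of sizes $r,s,t$. A decomposition of a graph into $5$-cycles is a partition of its edge set into edge sets of cycles of length $5$. *)

(* Defs.v *)
From mathcomp Require Import all_boot.

Set Implicit Arguments.
Unset Strict Implicit.
Unset Printing Implicit Defensive.

Definition edges (T : finType) (e : rel T) : {set {set T}} :=
  [set [set u.1; u.2] | u : T * T & e u.1 u.2].

Definition cycle_edges (T : finType) (c : seq T) : {set {set T}} :=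
  [set [set x; next c x] | x in c].

(* C is the edge set of a cycle on k distinct vertices; intended for 3 <= k,
   as shorter sequences are not cycles of a simple graph. *)
Definition is_cycle_of_length (k : nat) (T : finType) (e : rel T)
    (C : {set {set T}}) : Prop :=
  exists c : seq T, [/\ size c = k, ucycle e c & C = cycle_edges c].

Definition cycle_decomposable (k : nat) (T : finType) (e : rel T) : Prop :=
  exists P : {set {set {set T}}},
    partition P (edges e) /\
    (forall C : {set {set T}}, C \in P -> is_cycle_of_length k e C).

Definition tripartite_part (A B C : Type) (x : A + B + C) : nat :=
  match x with
  | inl (inl _) => 0
  | inl (inr _) => 1
  | inr _ => 2
  end.

Definition complete_tripartite (r s t : nat) : rel ('I_r + 'I_s + 'I_t)%type :=
  fun x y => tripartite_part x != tripartite_part y.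

Arguments complete_tripartite : clear implicits.

(* Main.v *)
Require Import Defs.
From mathcomp Require Import all_boot all_algebra.
From mathcomp Require Import zify.

(** Write [N = n * p = 5 q].  Call the vertices of [K_{r,s,t}] old and the [N] further
    vertices of each class new.  The old-old edges are decomposed by hypothesis, so the
    point is to decompose the graph of all the other edges.

    The new vertices of each class are cut into [q] blocks of five, indexed by [Z_q].
    The Latin square [k = i + j] sorts the new-new edges into [q ^ 2] cells: cell
    [(i, j)] consists of block [i] of class 0, block [j] of class 1 and block [i + j] of
    class 2.  An old vertex is attached to cells in such a way that it meets each block
    of the two other classes in exactly one of them: an old vertex of index [d] in [Z_q]
    is attached either to all cells that contain the block [d] of its own class, or, if
    [q] is odd, to all cells of slope [j - i = d].  The graph is then the edge-disjoint
    union of its cells, and a cell with [a], [b], [c] old vertices in the three classes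
    is [K_{a+5,b+5,c+5}] minus [K_{a,b,c}], a graph of bounded size.

    Such a cell has even degrees only if [a], [b], [c] have the same parity.  A
    decomposition of [K_{r,s,t}] forces [r], [s], [t] to have the same parity too, and
    forces [4 r s >= t (r + s)] and its two analogues ([tripartite_necessary]): every
    5-cycle uses an edge between any two given classes.  Three cases arise.
    - If [r] is even, the old vertices are dealt out in pairs to the [q] indices and
      attached by blocks; all cells are even.
    - If [r] and [q] are odd, one vertex of each class is set aside, the others are
      dealt out in pairs and attached by slope, and the three remaining vertices join the
      cells of slope 0, which become odd.
    - If [r] is odd and [q] is even, no slope is available.  The old vertices are dealt
      out as in the first case, except for one apex in each class.  The diagonal cells
      [(e, e)] with [e < q / 2] absorb the edges of the three apices: each takes those to
      its own three blocks and to three partner blocks, and the blocks and partner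
      blocks of these cells exhaust all blocks.
    Here [t <= 2 p] gives [t <= 10 q], and [t <= 5 q] in the last case, where [n] must be
    even; so cells have at most 10 old vertices in each class, and at most 6 in the last
    case.  Dealing out evenly turns the inequality [4 r s >= t (r + s)] into a condition
    on the cells ([balanced]), by monotonicity of the harmonic mean.

    What remains is a finite list of cells, each with an explicit decomposition
    ([rows], [covers_even], [covers_odd], [covers_apex]).  These are short because most
    of a cell is cyclic.  Let [x], [y] be old vertices of two classes and let
    [u_i], [v_i], [w_i] ([i] in [Z_5]) be the new vertices of the class of [x], of the
    class of [y] and of the third class.  The five cycles
    [x, v_(i+d), u_i, y, w_i] use all edges of [x] and [y] and the perfect matching of
    difference [d] between the blocks of the [u_i] and of the [v_i].  Only the part of a
    cell that such pairs leave over has to be listed, and most of that again comes in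
    orbits of [Z_5]. *)

Set Implicit Arguments.
Unset Strict Implicit.
Unset Printing Implicit Defensive.

Import GRing.Theory.

(** * Decompositions counted by multiplicity *)

Definition arcs (X : Type) (c : seq X) : seq (X * X) := zip c (rot 1 c).

Definition all_arcs (X : Type) (cs : seq (seq X)) := flatten (map (@arcs X) cs).

(** Arcs are counted in both directions, so that [multiplicity cs x y] is the number of
    times that the closed sequences in [cs] run along the edge [xy]. *)
Definition multiplicity (X : eqType) (cs : seq (seq X)) (x y : X) : nat :=
  count_mem (x, y) (all_arcs cs) + count_mem (y, x) (all_arcs cs).

Definition pentagon (X : eqType) (c : seq X) := (size c == 5) && uniq c.

(** Decompositions of multigraphs over an arbitrary [eqType], as lists rather than as
    partitions: this makes them additive in [w], and transportable along maps that are
    injective only where needed. *)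
Definition decomposes (X : eqType) (w : X -> X -> nat) : Prop :=
  exists2 cs, all (@pentagon X) cs & forall x y, multiplicity cs x y = w x y.

Section Calculus.
Variable X : eqType.
Implicit Types (w : X -> X -> nat) (cs : seq (seq X)).

Lemma eq_decomposes w1 w2 :
  (forall x y, w1 x y = w2 x y) -> decomposes w1 -> decomposes w2.
Proof. by move=> e [cs pcs wcs]; exists cs => // x y; rewrite wcs e. Qed.

Lemma decomposes0 : decomposes (fun _ _ : X => 0).
Proof. by exists [::]. Qed.

Lemma decomposesD w1 w2 :
  decomposes w1 -> decomposes w2 -> decomposes (fun x y => w1 x y + w2 x y).
Proof.
move=> [cs1 p1 e1] [cs2 p2 e2]; exists (cs1 ++ cs2); first by rewrite all_cat p1.
move=> x y; rewrite -e1 -e2 /multiplicity /all_arcs map_cat flatten_cat !count_cat.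
by rewrite addnACA.
Qed.

Lemma decomposes_sum (I : finType) (w : I -> X -> X -> nat) :
  (forall i, decomposes (w i)) -> decomposes (fun x y => \sum_i w i x y).
Proof.
move=> dw; elim: (index_enum I) => [|i r IHr].
  by apply: eq_decomposes decomposes0 => x y; rewrite big_nil.
by apply: eq_decomposes (decomposesD (dw i) IHr) => x y; rewrite big_cons.
Qed.

Lemma unzip_arcs (c : seq X) :
  unzip1 (arcs c) = c /\ unzip2 (arcs c) = rot 1 c.
Proof. by rewrite /arcs unzip1_zip ?unzip2_zip ?size_rot. Qed.

Lemma multiplicity_gt0 cs c x y :
  c \in cs -> (x, y) \in arcs c -> 0 < multiplicity cs x y.
Proof.
move=> c_cs xy_c; rewrite /multiplicity addn_gt0 -!has_count; apply/orP; left.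
by apply/hasP; exists (x, y) => //=; apply/flatten_mapP; exists c.
Qed.

Lemma mem_arc (c : seq X) x : x \in c -> exists y, (x, y) \in arcs c.
Proof.
by rewrite -{1}(unzip_arcs c).1 => /mapP[[a b] ab ->]; exists b.
Qed.

End Calculus.

(** The element of [ws] that has the same type and the same rank among the elements of
    its type as [x] has in [vs]. *)
Definition match_type (C X Y : eqType) (vs : seq X) (ws : seq Y)
    (tX : X -> C) (tY : Y -> C) (y0 : Y) (x : X) : Y :=
  nth y0 [seq y <- ws | tY y == tX x]
         (index x [seq x' <- vs | tX x' == tX x]).

Lemma match_typeP (C X Y : eqType) (live : pred C) (vs : seq X) (ws : seq Y)
    (tX : X -> C) (tY : Y -> C) x0 y0 :
  uniq ws -> (forall x, live (tX x) -> x \in vs) ->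
  (forall c, live c ->
     count (fun x => tX x == c) vs = count (fun y => tY y == c) ws) ->
  forall x, live (tX x) ->
    tY (match_type vs ws tX tY y0 x) = tX x /\
    match_type ws vs tY tX x0 (match_type vs ws tX tY y0 x) = x.
Proof.
move=> uws live_vs eqc x lx; set y := match_type _ _ _ _ y0 x.
have xin : x \in [seq x' <- vs | tX x' == tX x].
  by rewrite mem_filter eqxx live_vs.
have lt_i : index x [seq x' <- vs | tX x' == tX x]
            < size [seq y <- ws | tY y == tX x].
  by rewrite size_filter -eqc // -size_filter index_mem.
have yin : y \in [seq y <- ws | tY y == tX x] by apply: mem_nth.
have ty : tY y = tX x by move: yin; rewrite mem_filter => /andP[/eqP].
split=> //; rewrite /match_type ty /y /match_type index_uniq ?filter_uniq //.
by rewrite nth_index.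
Qed.

(** A graph in which adjacency depends only on the types of the two vertices is
    determined up to isomorphism, apart from isolated vertices, by the number of vertices
    of each type; [live] marks the types that may have a neighbour.  This lemma carries
    out every change of vertex set below. *)
Lemma decomposes_types (C X Y : eqType) (rho : rel C) (live : pred C)
    (vs : seq X) (ws : seq Y) (tX : X -> C) (tY : Y -> C) :
  (forall c c', rho c c' -> live c && live c') ->
  uniq vs -> uniq ws ->
  (forall x, live (tX x) -> x \in vs) ->
  (forall y, live (tY y) -> y \in ws) ->
  (forall c, live c ->
     count (fun x => tX x == c) vs = count (fun y => tY y == c) ws) ->
  decomposes (fun x x' => rho (tX x) (tX x')) ->
  decomposes (fun y y' => rho (tY y) (tY y')).
Proof.
move=> rho_live uvs uws live_vs live_ws eqc [cs pcs wcs].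
have noY : vs = [::] \/ ws = [::] -> forall y, ~~ live (tY y).
  move=> E y; apply/negP => ly.
  have : 0 < count (fun y' => tY y' == tY y) ws.
    by rewrite -has_count; apply/hasP; exists y; rewrite ?live_ws.
  by case: E => E; [rewrite -eqc // E | rewrite E].
case: vs uvs live_vs eqc noY => [|x0 vs'] uvs live_vs eqc noY.
  apply: eq_decomposes (@decomposes0 _) => y y'; case E: rho => //.
  by have := noY (or_introl erefl) y; case/andP: (rho_live _ _ E) => ->.
case: ws uws live_ws eqc noY => [|y0 ws'] uws live_ws eqc noY.
  apply: eq_decomposes (@decomposes0 _) => y y'; case E: rho => //.
  by have := noY (or_intror erefl) y; case/andP: (rho_live _ _ E) => ->.
set vs := x0 :: vs' in uvs live_vs eqc; set ws := y0 :: ws' in uws live_ws eqc.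
have hP := match_typeP x0 y0 uws live_vs eqc.
have h'P := match_typeP y0 x0 uvs live_ws (fun c l => esym (eqc c l)).
move: (match_type vs ws tX tY y0) (match_type ws vs tY tX x0) hP h'P.
move=> h h' hP h'P.
have live_arc a b : (a, b) \in all_arcs cs -> live (tX a) && live (tX b).
  case/flatten_mapP => c c_cs ab; have := multiplicity_gt0 c_cs ab.
  by rewrite wcs lt0b => /rho_live.
have live_cs c x : c \in cs -> x \in c -> live (tX x).
  move=> c_cs /mem_arc[y xy]; have /live_arc/andP[] // : (x, y) \in all_arcs cs.
  by apply/flatten_mapP; exists c.
have hK c x : c \in cs -> x \in c -> h' (h x) = x.
  by move=> c_cs /live_cs-/(_ c_cs)/hP[].
have all_arcs_h :
    all_arcs (map (map h) cs) = [seq (h p.1, h p.2) | p <- all_arcs cs].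
  rewrite /all_arcs map_flatten -!map_comp; congr flatten; apply: eq_map => c.
  rewrite /= /arcs -map_rot; elim: c (rot 1 c) => [|x c IHc] [|y d] //=.
  by rewrite IHc.
exists (map (map h) cs).
  rewrite all_map; apply/allP => c c_cs.
  have /andP[sz uc] := allP pcs c c_cs.
  rewrite /= /pentagon size_map sz map_inj_in_uniq //.
  by move=> a b /(hK _ _ c_cs) {2}<- /(hK _ _ c_cs) {2}<- ->.
move=> y y'.
(* Images of arcs are live, so pairs with a dead vertex have multiplicity 0. *)
have dead p : p \in all_arcs cs -> live (tY (h p.1)) && live (tY (h p.2)).
  by case: p => a b /live_arc /andP[la lb]; rewrite !(hP _ _).1 ?la.
case ly: (live (tY y) && live (tY y')); last first.
  rewrite /multiplicity all_arcs_h !count_map !(eq_in_count (a2 := pred0)) ?count_pred0.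
  - by case E: rho => //; rewrite rho_live in ly.
  - by move=> p /dead /andP[l1 l2]; apply/eqP => -[e1 e2]; rewrite -e1 -e2 l1 l2 in ly.
  by move=> p /dead /andP[l1 l2]; apply/eqP => -[e1 e2]; rewrite -e1 -e2 l1 l2 in ly.
have {ly} [ly ly'] := andP ly.
have [t_y hy] := h'P _ ly; have [t_y' hy'] := h'P _ ly'.
rewrite -t_y -t_y' -wcs /multiplicity all_arcs_h !count_map.
have key u u' : h (h' u) = u -> h (h' u') = u' ->
    count (preim (fun p => (h p.1, h p.2)) (pred1 (u, u'))) (all_arcs cs) =
    count_mem (h' u, h' u') (all_arcs cs).
  move=> eu eu'; apply: eq_in_count => -[a b] /live_arc/andP[/hP[_ ea] /hP[_ eb]] /=.
  apply/eqP/eqP => -[]; first by move=> <- <-; rewrite ea eb.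
  by move=> -> ->; rewrite eu eu'.
by rewrite !key.
Qed.

(** * Comparison with partitions of the edge set *)

Lemma set2_inj (T : finType) (a b x y : T) :
  [set a; b] = [set x; y] -> (a, b) = (x, y) \/ (a, b) = (y, x).
Proof.
move=> E.
have : a \in [set x; y] by rewrite -E set21.
have : b \in [set x; y] by rewrite -E set22.
have : x \in [set a; b] by rewrite E set21.
have : y \in [set a; b] by rewrite E set22.
rewrite !inE => /orP[] /eqP h1 /orP[] /eqP h2 /orP[] /eqP h3 /orP[] /eqP h4;
  by subst; auto.
Qed.

Lemma arcs_next (T : eqType) (c : seq T) :
  uniq c -> arcs c = [seq (x, next c x) | x <- c].
Proof.
move=> uc; have -> : [seq (x, next c x) | x <- c] = zip c (map (next c) c).
  by move: (next c) => f; elim: c {uc} => //= x s ->.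
congr zip; case: c uc => // a s uc.
have sz : size (rot 1 (a :: s)) = size (map (next (a :: s)) (a :: s)).
  by rewrite size_rot size_map.
apply: (eq_from_nth (x0 := a)) => // i; rewrite size_rot => lt_i.
rewrite (nth_map a) // next_nth mem_nth // index_uniq //.
rewrite rot1_cons nth_rcons; move: lt_i; rewrite /= ltnS leq_eqVlt.
by case/orP=> [/eqP->|->] //; rewrite ltnn eqxx nth_default.
Qed.

Lemma multiplicityE (X : eqType) (cs : seq (seq X)) x y :
  multiplicity cs x y =
  \sum_(c <- cs) (count_mem (x, y) (arcs c) + count_mem (y, x) (arcs c)).
Proof.
rewrite big_split /= /multiplicity /all_arcs !count_flatten -!map_comp !sumnE !big_map.
by [].
Qed.

Section Bridge.
Variable T : finType.
Implicit Types (c : seq T) (C : {set {set T}}).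

Lemma cycle_edgesP c x y : uniq c ->
  reflect ((x, y) \in arcs c \/ (y, x) \in arcs c) ([set x; y] \in cycle_edges c).
Proof.
move=> uc; rewrite arcs_next //; apply: (iffP imsetP) => [[z z_c] /set2_inj|].
  by case=> -[-> ->]; [left | right]; apply: (map_f (fun x => (x, next c x))).
by case=> /mapP[z z_c [-> ->]]; exists z => //; rewrite setUC.
Qed.

(** A pentagon never runs along the same edge in both directions, since going back and
    forth would close it up after two steps. *)
Lemma pentagon_multiplicity c x y : pentagon c ->
  count_mem (x, y) (arcs c) + count_mem (y, x) (arcs c)
  = ([set x; y] \in cycle_edges c).
Proof.
case/andP=> sz_c uc; have ua : uniq (arcs c).
  by rewrite arcs_next // map_inj_uniq // => a b [].
rewrite !count_uniq_mem //.
have [xy|xy] := boolP ((x, y) \in arcs c); last first.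
  congr nat_of_bool; apply/idP/(cycle_edgesP x y uc) => [|[]//]; first by right.
  by rewrite (negPf xy).
have -> : [set x; y] \in cycle_edges c by apply/(cycle_edgesP x y uc); left.
case: (boolP ((y, x) \in arcs c)) => // yx; exfalso; move: xy yx.
rewrite arcs_next // => /mapP[a a_c [-> ->]] /mapP[b b_c [<- /esym]] {b b_c}.
have [i s rot_c] := rot_to a_c.
have nextE z : next c z = next (a :: s) z by rewrite -rot_c next_rot.
move: (uc); rewrite -(rot_uniq i) rot_c !nextE {nextE}.
case: s rot_c => [|b [|d s]] rot_c;
  try by move: sz_c; rewrite -(size_rot i) rot_c.
rewrite /= eqxx !inE !negb_or => /andP[/and3P[nab nad _] _].
rewrite eq_sym (negPf nab) eqxx => E; by rewrite E eqxx in nad.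
Qed.

Lemma decomposes_cycle_decomposable (e : rel T) : irreflexive e ->
  decomposes (fun x y => e x y : nat) -> cycle_decomposable 5 e.
Proof.
move=> irr_e [cs pcs wcs].
have eE x y : e x y = (0 < multiplicity cs x y) by rewrite wcs lt0b.
have sym_e x y : e x y = e y x by rewrite !eE /multiplicity addnC.
have pc c : c \in cs -> pentagon c by move/(allP pcs).
have uc c : c \in cs -> uniq c by move/pc/andP=> [].
have edge_e x y : ([set x; y] \in edges e) = e x y.
  apply/imsetP/idP => [[[a b]]|exy]; last by exists (x, y); rewrite ?inE.
  by rewrite inE /= => eab /set2_inj[] [-> ->] //; rewrite sym_e.
have edge_cs c x y : c \in cs -> [set x; y] \in cycle_edges c -> e x y.
  move=> c_cs; rewrite eE => /(cycle_edgesP _ _ (uc _ c_cs))[] xy.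
    exact: multiplicity_gt0 xy.
  by rewrite /multiplicity addnC; apply: multiplicity_gt0 xy.
exists [set C in map (@cycle_edges T) cs]; split; last first.
  move=> C; rewrite inE => /mapP[c c_cs ->]; exists c.
  have /andP[/eqP sz_c u_c] := pc c c_cs; split=> //; apply/andP; split=> //.
  apply: cycle_from_next => // x x_c; apply: (edge_cs c) => //.
  by apply: (imset_f (fun x => [set x; next c x])).
apply/and3P; split.
- apply/eqP/setP => E; apply/bigcupP/idP => [[C]|/imsetP[[x y]]].
    rewrite inE => /mapP[c c_cs ->] Ec; case/imsetP: (Ec) => x _ E_x.
    by rewrite E_x edge_e; apply: (edge_cs c); rewrite -?E_x.
  rewrite inE /= eE => exy ->.
  move: exy; rewrite /multiplicity addn_gt0 -!has_count !has_pred1.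
  case/orP=> /flatten_mapP[c c_cs xy]; exists (cycle_edges c);
    rewrite ?inE ?map_f //; apply/cycle_edgesP; rewrite ?uc //; by [left | right].
- apply/trivIsetP => A B; rewrite !inE => /mapP[c c_cs ->] /mapP[c' c'_cs ->] nAB.
  apply/pred0P => E /=; apply/negP => /andP[Ec Ec'].
  case/imsetP: (Ec) => x _ E_x; move: Ec Ec'; rewrite {}E_x.
  set y := next c x => xy xy'.
  have : multiplicity cs x y <= 1 by rewrite wcs leq_b1.
  have nc : c' != c by apply: contraNneq nAB => ->.
  rewrite multiplicityE (big_rem c) //= (big_rem c') /=; last first.
    exact: rem_mem.
  by rewrite addnA pentagon_multiplicity ?pc // pentagon_multiplicity ?pc // xy xy'.
- rewrite inE; apply/mapP => -[c c_cs /setP]; have /andP[/eqP sz_c _] := pc c c_cs.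
  case: c c_cs sz_c => // x c _ _ /(_ [set x; next (x :: c) x]).
  rewrite inE => /esym/negP[]; apply: (imset_f (fun z => [set z; next (x :: c) z])).
  by rewrite mem_head.
Qed.

Lemma cycle_decomposable_decomposes (e : rel T) : symmetric e -> irreflexive e ->
  cycle_decomposable 5 e -> decomposes (fun x y => e x y : nat).
Proof.
move=> sym_e irr_e [P [/and3P[/eqP cov_P tr_P _] cycP]].
have edge_e x y : ([set x; y] \in edges e) = e x y.
  apply/imsetP/idP => [[[a b]]|exy]; last by exists (x, y); rewrite ?inE.
  by rewrite inE /= => eab /set2_inj[] [-> ->] //; rewrite sym_e.
have /fin_all_exists[f fP] : forall C : {set {set T}}, exists c : seq T,
    C \in P -> pentagon c /\ C = cycle_edges c.
  move=> C; case: (boolP (C \in P)) => [/cycP[c [/eqP sz /andP[_ uc] EC]]|_].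
    by exists c => _; split=> //; apply/andP.
  by exists [::].
exists (map f (enum P)).
  by apply/allP => c /mapP[C]; rewrite mem_enum => /fP[pc _] ->.
move=> x y; rewrite multiplicityE big_map big_enum /=.
rewrite (eq_bigr (fun C : {set {set T}} => ([set x; y] \in C : nat))); last first.
  by move=> C /fP[pc EC]; rewrite pentagon_multiplicity // -EC.
rewrite -edge_e -cov_P.
case: (boolP ([set x; y] \in cover P)) => [/bigcupP[C CP xyC]|xyP].
  rewrite (bigD1 C) //= xyC big1 // => D /andP[DP nDC].
  have /trivIsetP/(_ _ _ DP CP nDC)/disjointFl -> // := tr_P.
rewrite big1 // => C CP; apply/eqP; rewrite eqb0.
by apply: contraNN xyP => xyC; apply/bigcupP; exists C.
Qed.

End Bridge.

(** * Degree and colour conditions *)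

Lemma sum_count_mem (P : finType) (F : P -> nat) (L : seq P) :
  \sum_p F p * count_mem p L = \sum_(p <- L) F p.
Proof.
elim: L => [|a L IHL] /=; first by rewrite big_nil big1 // => p; rewrite muln0.
rewrite big_cons -IHL (eq_bigr (fun p => F p * (a == p) + F p * count_mem p L)).
  rewrite big_split /= (bigD1 a) //= eqxx muln1 big1 ?addn0 // => p.
  by rewrite eq_sym => /negPf->; rewrite muln0.
by move=> p _; rewrite mulnDr.
Qed.

Lemma sum_multiplicity (T : finType) (F : T -> T -> nat) (cs : seq (seq T)) :
  \sum_x \sum_y F x y * multiplicity cs x y =
  \sum_(c <- cs) \sum_(p <- arcs c) (F p.1 p.2 + F p.2 p.1).
Proof.
transitivity (\sum_(p <- all_arcs cs) (F p.1 p.2 + F p.2 p.1)).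
  rewrite big_split /= -(sum_count_mem (fun p => F p.1 p.2)).
  rewrite -(sum_count_mem (fun p => F p.2 p.1)).
  transitivity (\sum_x \sum_y F x y * count_mem (x, y) (all_arcs cs) +
                \sum_x \sum_y F x y * count_mem (y, x) (all_arcs cs)).
    rewrite -big_split; apply: eq_bigr => x _; rewrite -big_split.
    by apply: eq_bigr => y _; rewrite mulnDr.
  congr addn; last rewrite exchange_big /=;
    by rewrite pair_bigA; apply: eq_bigr => -[].
by rewrite /all_arcs big_flatten big_map.
Qed.

(** Each closed sequence enters and leaves a vertex equally often. *)
Lemma decomposes_even_degree (T : finType) (w : T -> T -> nat) x :
  decomposes w -> ~~ odd (\sum_y w x y).
Proof.
case=> cs pcs wcs; have : \sum_z \sum_y (z == x) * multiplicity cs z y = \sum_y w x y.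
  rewrite (bigD1 x) //= [X in _ + X]big1 ?addn0 => [|z /negPf zx].
    by apply: eq_bigr => y _; rewrite eqxx mul1n wcs.
  by rewrite big1 // => y; rewrite zx mul0n.
rewrite (sum_multiplicity (fun z y => z == x)) => <-.
rewrite (eq_bigr (fun c => (count_mem x c).*2)).
  elim/big_ind: _ => // [a b /negPf ea /negPf eb|c _]; rewrite ?odd_double //.
  by rewrite oddD ea eb.
have count_sum (s : seq T) : \sum_(z <- s) (z == x) = count_mem x s.
  by rewrite -sum1_count [RHS]big_mkcond; apply: eq_bigr => z _ /=; case: (z == x).
move=> c _; rewrite big_split /= -addnn -(big_map fst xpredT (fun z => (z == x) : nat)).
rewrite -(big_map snd xpredT (fun z => (z == x) : nat)) /= !count_sum.
rewrite -[map fst _]/(unzip1 _) -[map snd _]/(unzip2 _).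
rewrite (unzip_arcs c).1 (unzip_arcs c).2; congr addn.
by apply/permP; rewrite perm_rot.
Qed.

(** If no edge of a 3-coloured pentagon joined the colours [i] and [j], then the third
    colour would occur on every other vertex, which an odd cycle does not allow. *)
Lemma pentagon_crosses (X : eqType) (cls : X -> nat) (c : seq X) i j :
  size c = 5 -> (forall p, p \in arcs c ->
    [&& cls p.1 < 3, cls p.2 < 3 & cls p.1 != cls p.2]) ->
  i < 3 -> j < 3 -> i != j ->
  0 < \sum_(p <- arcs c) ((cls p.1 == i) && (cls p.2 == j) +
                          (cls p.2 == i) && (cls p.1 == j)).
Proof.
move=> sz_c arcP i3 j3 nij; rewrite lt0n; apply/negP => sum0.
pose k := 3 - i - j.
have alt p : p \in arcs c -> (cls p.1 == k) = ~~ (cls p.2 == k).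
  move=> p_c; have /and3P[] := arcP p p_c.
  move: sum0; rewrite (big_rem p) //= addn_eq0 => /andP[].
  rewrite /k {k}; case: (cls p.1) => [|[|[|?]]] // ; case: (cls p.2) => [|[|[|?]]] //;
    by case: i i3 nij => [|[|[|?]]] //; case: j j3 => [|[|[|?]]].
case: c sz_c alt {arcP sum0} => [|x0 [|x1 [|x2 [|x3 [|x4 [|]]]]]] // _.
rewrite /arcs /= => alt.
have := alt (x0, x1); have := alt (x1, x2); have := alt (x2, x3).
have := alt (x3, x4); have := alt (x4, x0).
rewrite !inE !eqxx ?orbT /= => /(_ isT)-> /(_ isT)-> /(_ isT)-> /(_ isT)->.
by move=> /(_ isT); case: eqP.
Qed.

(** With [m] cycles, [m] is at most each of the three edge counts because every cycle
    meets each of the three pairs of classes. *)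
Lemma tripartite_cycle_count (T : finType) (cls : T -> nat) (n : nat -> nat) :
  (forall x, cls x < 3) -> (forall i, \sum_x (cls x == i) = n i) ->
  decomposes (fun x y => cls x != cls y) ->
  exists m, [/\ n 0 * n 1 + n 0 * n 2 + n 1 * n 2 = 5 * m, m <= n 0 * n 1,
                m <= n 0 * n 2 & m <= n 1 * n 2].
Proof.
move=> cls3 nE [cs pcs wcs]; exists (size cs).
have cross i j : i < 3 -> j < 3 -> i != j -> size cs <= n i * n j.
  move=> i3 j3 nij.
  have -> : n i * n j = \sum_x \sum_y ((cls x == i) && (cls y == j)) * multiplicity cs x y.
    rewrite -!nE big_distrlr /=; apply: eq_bigr => x _; apply: eq_bigr => y _.
    by rewrite wcs; case: eqP => //= ->; case: eqP => //= ->; rewrite nij.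
  rewrite (sum_multiplicity (fun x y => (cls x == i) && (cls y == j))) -sum1_size.
  rewrite !big_seq; apply: leq_sum => c c_cs.
  apply: pentagon_crosses => //; first by case/andP: (allP pcs c c_cs) => /eqP.
  by case=> x y /(multiplicity_gt0 c_cs); rewrite wcs lt0b !cls3.
split; try exact: cross.
have: \sum_x \sum_y 1 * multiplicity cs x y = 10 * size cs.
  rewrite (sum_multiplicity (fun _ _ => 1)) (eq_big_seq (fun=> 10)).
    by rewrite big_const_seq count_predT iter_addn_0.
  move=> c /(allP pcs) /andP[/eqP sz_c _].
  by rewrite big_const_seq count_predT iter_addn_0 size_zip size_rot sz_c.
have -> : \sum_x \sum_y 1 * multiplicity cs x y =
    \sum_x \sum_y ((cls x == 0) * (cls y == 1) + (cls x == 1) * (cls y == 0) +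
      ((cls x == 0) * (cls y == 2) + (cls x == 2) * (cls y == 0)) +
      ((cls x == 1) * (cls y == 2) + (cls x == 2) * (cls y == 1))).
  apply: eq_bigr => x _; apply: eq_bigr => y _; rewrite mul1n wcs.
  by move: (cls3 x) (cls3 y); case: (cls x) => [|[|[|]]] //; case: (cls y) => [|[|[|]]].
have prod i j : \sum_x \sum_y (cls x == i) * (cls y == j) = n i * n j.
  by rewrite -!nE big_distrlr.
rewrite (eq_bigr _ (fun x _ => big_split _ _ _ _ _)) big_split /=.
under eq_bigr do rewrite !big_split /=.
under [X in _ + X]eq_bigr do rewrite !big_split /=.
rewrite !big_split /= !prod; lia.
Qed.

(** * Cells *)

(** A vertex type is a class together with a kind relative to a given cell: kind 0 is a
    new vertex of the cell, kind 1 an old vertex attached to it, kind 2 a new vertex of a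
    partner block, kind 3 an apex; any other kind lies outside the cell. *)
Definition linked (a b : nat) : bool :=
  match a, b with
  | 0, 0 | 0, 1 | 1, 0 | 0, 3 | 3, 0 | 2, 3 | 3, 2 => true
  | _, _ => false
  end.

Definition joined (s t : nat * nat) : bool :=
  [&& s.1 < 3, t.1 < 3, s.1 != t.1 & linked s.2 t.2].

Definition live (s : nat * nat) : bool := (s.1 < 3) && (s.2 < 4).

Lemma linkedC a b : linked a b = linked b a.
Proof. by case: a => [|[|[|[|]]]]; case: b => [|[|[|[|]]]]. Qed.

Lemma joinedC s t : joined s t = joined t s.
Proof. by rewrite /joined linkedC eq_sym; case: (_ < 3); case: (_ < 3). Qed.

Lemma joined_live s t : joined s t -> live s && live t.
Proof.
case: s t => [a k] [b l] /and4P[/= a3 b3 _]; rewrite /live /= a3 b3.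
by case: k => [|[|[|[|]]]]; case: l => [|[|[|[|]]]].
Qed.

(** Partner blocks and apices are present exactly when the flag [f] is set. *)
Definition profile (n : seq nat) (f : bool) (s : nat * nat) : nat :=
  match s.2 with 0 => 5 | 1 => nth 0 n s.1 | 2 => f * 5 | _ => f end.

Definition cell_decomposes (n : seq nat) (f : bool) : Prop :=
  forall (U : finType) (ty : U -> nat * nat),
    (forall s, live s -> #|[pred x | ty x == s]| = profile n f s) ->
    decomposes (fun x y => joined (ty x) (ty y)).

(** Permuting the classes changes neither the graph nor, up to order, its profile. *)
Lemma cell_decomposes_perm n n' f :
  size n = 3 -> perm_eq n' n -> cell_decomposes n f -> cell_decomposes n' f.
Proof.
move=> sz_n /(perm_iotaP 0)[Is pIs ->] dn U ty tyP.
rewrite sz_n in pIs.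
have sz_Is : size Is = 3 by rewrite (perm_size pIs) size_iota.
have uIs : uniq Is by rewrite (perm_uniq pIs) iota_uniq.
have ltIs c : c < 3 -> nth 3 Is c < 3.
  move=> c3; have : nth 3 Is c \in Is by rewrite mem_nth ?sz_Is.
  by rewrite (perm_mem pIs) mem_iota.
have geIs c : ~~ (c < 3) -> nth 3 Is c = 3.
  by rewrite -leqNgt => c3; rewrite nth_default ?sz_Is.
pose ty' x := (nth 3 Is (ty x).1, (ty x).2).
have joinedE x y : joined (ty' x) (ty' y) = joined (ty x) (ty y).
  rewrite /joined /=; case: (boolP ((ty x).1 < 3)) => [x3|/geIs-> //].
  case: (boolP ((ty y).1 < 3)) => [y3|/geIs->]; last by rewrite andbF.
  by rewrite !ltIs // nth_uniq ?sz_Is.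
apply: eq_decomposes (dn U ty' _) => [x y|]; first by rewrite joinedE.
case=> d k /andP[/= d3 k4].
have /(nthP 3)[c] : d \in Is by rewrite (perm_mem pIs) mem_iota.
rewrite sz_Is => c3 <-; rewrite (eq_card (B := [pred x | ty x == (c, k)])).
  rewrite tyP ?/live ?c3 //; case: k k4 => [|[|[|[|]]]] // _.
  by rewrite /profile /= (nth_map 3) ?sz_Is.
move=> x; rewrite !inE /ty'; case: (ty x) => [a b] /=; rewrite !xpair_eqE.
congr (_ && _); case: (ltnP a 3) => a3; first by rewrite nth_uniq ?sz_Is.
rewrite geIs -?leqNgt //; have := ltIs c c3; lia.
Qed.

(** Concrete names for the vertices of a cell.  The name [(c, l)] with [c < 3] is a new
    vertex if [l < 5] and an old one otherwise; [(3 + c, l)] belongs to class [c] and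
    is in the partner block if [l < 5] and the apex if [l = 5]. *)
Definition label_type (v : nat * nat) : nat * nat :=
  if v.1 < 3 then (v.1, (4 < v.2) : nat) else (v.1 - 3, (4 < v.2).+2).

Definition labels (n : seq nat) (f : bool) : seq (nat * nat) :=
  [seq (c, l) | c <- iota 0 3, l <- iota 0 (5 + nth 0 n c)] ++
  (if f then [seq (c, l) | c <- iota 3 3, l <- iota 0 6] else [::]).

Definition lexlt (u v : nat * nat) : bool :=
  (u.1 < v.1) || (u.1 == v.1) && (u.2 < v.2).

Definition orient (p : (nat * nat) * (nat * nat)) :=
  if lexlt p.1 p.2 then p else (p.2, p.1).

Definition cell_edges n f : seq ((nat * nat) * (nat * nat)) :=
  [seq p <- [seq (u, v) | u <- labels n f, v <- labels n f] |
     lexlt p.1 p.2 && joined (label_type p.1) (label_type p.2)].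

Definition lexle2 (p q : (nat * nat) * (nat * nat)) : bool :=
  lexlt p.1 q.1 || (p.1 == q.1) && ~~ lexlt q.2 p.2.

(** Since the labels are listed in lexicographic order, so are the edges, and it is
    enough to sort the arcs of [cs]. *)
Definition checks n f cs : bool :=
  [&& all (@pentagon _) cs,
      sort lexle2 (map orient (all_arcs cs)) == cell_edges n f,
      uniq (labels n f) &
      all (fun s => count (fun v => label_type v == s) (labels n f)
                    == profile n f s)
          [seq (c, k) | c <- iota 0 3, k <- iota 0 4]].

Lemma orient_eq p q : p.1 != p.2 ->
  (orient q == orient p) = (q == p) || (q == (p.2, p.1)).
Proof.
case: p q => [[a b] [c d]] [[a' b'] [c' d']]; rewrite /orient /lexlt /=.
case: ifP => h1; case: ifP => h2; rewrite !xpair_eqE /= => h; lia.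
Qed.

Lemma count_enum (T : finType) (a : pred T) : count a (enum T) = #|a|.
Proof. by rewrite -size_filter cardE [enum a]/enum_mem -enumT. Qed.

Lemma checks_cell_decomposes n f cs : checks n f cs -> cell_decomposes n f.
Proof.
case/and4P=> pcs /eqP sort_eq uniq_lab /allP prof U ty tyP.
have {sort_eq} arcs_perm : perm_eq (map orient (all_arcs cs)) (cell_edges n f).
  by rewrite -sort_eq perm_sym perm_sort.
(* Every label outside the cell receives the dead type [(3, 4)]. *)
pose lt v := if v \in labels n f then label_type v else (3, 4).
apply: (@decomposes_types _ _ _ joined live (labels n f) (enum U) lt ty) => //.
- exact: joined_live.
- exact: enum_uniq.
- by move=> x; rewrite /lt; case: ifP.
- by move=> y _; rewrite mem_enum.
- move=> s ls; rewrite count_enum tyP //.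
  have /prof/eqP<- : s \in [seq (c, k) | c <- iota 0 3, k <- iota 0 4].
    case: s ls => c k /andP[/= c3 k4].
    by case: c c3 => [|[|[|]]] // _; case: k k4 => [|[|[|[|]]]].
  by apply: eq_in_count => x x_lab; rewrite /lt x_lab.
exists cs => // u v.
have mult_orient : u != v ->
    multiplicity cs u v = (orient (u, v) \in cell_edges n f).
  move=> nuv; rewrite -count_uniq_mem; last first.
    by rewrite filter_uniq // allpairs_uniq // => -[? ?] [].
  rewrite -(permP arcs_perm) count_map /multiplicity.
  rewrite -[RHS](eq_count (a1 := predU (pred1 (u, v)) (pred1 (v, u)))); last first.
    by move=> q; rewrite /= orient_eq.
  rewrite -count_predUI (eq_count (a1 := predI _ _) (a2 := pred0)) ?count_pred0 ?addn0 //.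
  by move=> q /=; apply/negP => /andP[/eqP-> /eqP[/eqP]]; rewrite (negPf nuv).
have in_edges u' v' : ((u', v') \in cell_edges n f) =
    [&& u' \in labels n f, v' \in labels n f, lexlt u' v' &
        joined (label_type u') (label_type v')].
  rewrite /cell_edges; move: (labels n f) => L.
  rewrite mem_filter /= andbC [RHS]andbA; congr (_ && _).
  apply/idP/andP => [/flatten_mapP[x xL /mapP[y yL [-> ->]]] //|[u'L v'L]].
  by apply/flatten_mapP; exists u' => //; apply: map_f.
have lt_joined a b : joined (lt a) (lt b) =
    [&& a \in labels n f, b \in labels n f & joined (label_type a) (label_type b)].
  rewrite /lt; case: (a \in _); case: (b \in _) => //=; rewrite ?[joined (3, 4) _]/= //.
  by rewrite joinedC.
have [<-|nuv] := eqVneq u v.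
  have -> : joined (lt u) (lt u) = false by rewrite /joined eqxx !andbF.
  rewrite /multiplicity addnn; apply/eqP; rewrite double_eq0 -leqn0 leqNgt -has_count has_pred1.
  apply/negP => uu; have := map_f orient uu; rewrite (perm_mem arcs_perm).
  by rewrite /orient if_same in_edges /lexlt !ltnn eqxx !andbF.
rewrite mult_orient // lt_joined; congr nat_of_bool; rewrite /orient; case: ifP => /= uv.
  by rewrite in_edges uv.
have vu : lexlt v u.
  by move: u v uv nuv {mult_orient} => [a b] [c d]; rewrite /lexlt xpair_eqE /=; lia.
by rewrite in_edges vu joinedC /=; case: (u \in _); case: (v \in _).
Qed.

(** * Explicit decompositions of the cells *)

Definition label_cycle := seq (nat * nat).

(** The action of [Z_5] on labels: new vertices and partner blocks are rotated, old
    vertices and apices (whose second component is at least 5) are fixed. *)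
Definition shift (s : nat) (v : nat * nat) : nat * nat :=
  if v.2 < 5 then (v.1, (v.2 + s) %% 5) else v.

Definition develop (c : label_cycle) : seq label_cycle :=
  [seq map (shift s) c | s <- iota 0 5].

(** The differences [d] for which no arc of [cs] joins the new vertices [i] of class [a]
    and [i + d] of class [b]; they are left for pairs. *)
Definition free_diffs (cs : seq label_cycle) (a b : nat) : seq nat :=
  [seq d <- iota 0 5 | ~~ has (fun p =>
     [&& p.1.1 == a, p.2.1 == b, p.1.2 < 5, p.2.2 < 5 &
         (p.2.2 + 5 - p.1.2) %% 5 == d])
     (all_arcs cs ++ [seq (p.2, p.1) | p <- all_arcs cs])].

Definition next_old (cs : seq label_cycle) (a : nat) : nat :=
  foldr maxn 5 [seq v.2.+1 | v <- flatten cs & v.1 == a].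

(** Developed modulo 5, this cycle uses all edges between the old vertices [(a, i)],
    [(b, j)] and the new vertices, and the matching of difference [d] between the
    classes [a] and [b]. *)
Definition pair_cycle (a b : nat) (i j d : nat) : label_cycle :=
  [:: (a, i); (b, d); (a, 0); (b, j); (3 - a - b, 0)].

(** The analogue of [pair_cycle] for two apices: the common neighbour is taken in the
    partner block of the third class.  Two of the three apex orbits meet at each apex and
    use up its edges to both blocks of each of the other two classes. *)
Definition apex_cycle (a b d : nat) : label_cycle :=
  [:: (3 + a, 5); (b, d); (a, 0); (3 + b, 5); (6 - a - b, 0)].

Definition pair_cycles (a b i j : nat) (ds : seq nat) : seq label_cycle :=
  [seq pair_cycle a b (i + p.1) (j + p.1) p.2 | p <- zip (iota 0 (size ds)) ds].

(** When apices are present, the first free difference between any two classes is spent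
    on them instead of on a pair of old vertices. *)
Definition pair_diffs (f : bool) (ds : seq nat) := if f then behead ds else ds.

Definition row_base (r : seq label_cycle * seq label_cycle) : seq label_cycle :=
  r.1 ++ flatten (map develop r.2).

(** A row consists of a core, which is a list of cycles, and of starters, which are
    cycles to be developed modulo 5.  All differences that they leave free are spent on
    pairs of further old vertices, one pair for each difference. *)
Definition cell_cycles (f : bool) (r : seq label_cycle * seq label_cycle) :
    seq label_cycle :=
  let cs := row_base r in
  let d01 := free_diffs cs 0 1 in
  let d02 := free_diffs cs 0 2 in
  let d12 := free_diffs cs 1 2 in
  let u := size (pair_diffs f d01) in
  let v := size (pair_diffs f d02) in
  cs ++ flatten (map develop (
    pair_cycles 0 1 (next_old cs 0) (next_old cs 1) (pair_diffs f d01) ++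
    pair_cycles 0 2 (next_old cs 0 + u) (next_old cs 2) (pair_diffs f d02) ++
    pair_cycles 1 2 (next_old cs 1 + u) (next_old cs 2 + v) (pair_diffs f d12) ++
    (if f then [:: apex_cycle 0 1 (head 0 d01); apex_cycle 0 2 (head 0 d02);
                  apex_cycle 1 2 (head 0 d12)] else [::]))).

Definition cell_sizes (f : bool) (r : seq label_cycle * seq label_cycle) : seq nat :=
  [seq next_old (cell_cycles f r) a - 5 | a <- iota 0 3].

(** The number with decimal digits [c l] stands for the label [(c, l)]. *)
Definition decode (d : nat) : nat * nat := (d %/ 10, d %% 10).

(** Each entry is a core with the lists of starters that complete it to a row.  Nothing
    is assumed about these numbers: they enter only through [checks]. *)
Definition rows : seq (seq (seq nat) * seq (seq (seq nat))) := [::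
  ([::], [:: [:: [:: 0; 10; 1; 12; 20]; [:: 0; 21; 2; 20; 13];
    [:: 10; 21; 11; 20; 3]]; [:: [:: 0; 10; 1; 12; 20]]; [::]; [::
    [:: 5; 10; 0; 11; 20]]]);
  ([:: [:: 0; 10; 4; 25; 11]; [:: 0; 20; 14; 3; 25]; [:: 1; 11; 22; 2; 25];
    [:: 1; 12; 25; 10; 21]; [:: 2; 12; 23; 3; 13]; [:: 4; 14; 25; 13; 24]], [:: [::
    [:: 5; 10; 1; 13; 20]; [:: 10; 20; 11; 24; 2]]; [:: [:: 26; 0; 12; 20; 10];
    [:: 0; 21; 2; 20; 13]]; [:: [:: 26; 0; 12; 3; 11]]; [:: [:: 5; 10; 1; 13; 20]];
    [:: [:: 5; 10; 20; 1; 22]]; [:: [:: 0; 21; 2; 20; 12]; [:: 10; 20; 11; 23; 1]];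
    [:: [:: 0; 12; 3; 11; 21]]; [:: [:: 0; 21; 2; 20; 12]]; [::]]);
  ([:: [:: 0; 10; 21; 14; 20]; [:: 0; 15; 22; 10; 25]; [:: 1; 11; 23; 15; 21];
    [:: 1; 15; 20; 13; 25]; [:: 2; 12; 25; 11; 22]; [:: 2; 15; 4; 14; 25];
    [:: 3; 13; 24; 4; 25]; [:: 3; 15; 24; 12; 23]], [:: [:: [:: 0; 11; 2; 10; 24];
    [:: 0; 21; 3; 20; 12]]; [:: [:: 0; 11; 2; 10; 23]]; [::]; [::
    [:: 5; 10; 1; 12; 20]; [:: 0; 21; 3; 22; 12]]; [:: [:: 5; 10; 20; 11; 24]]; [::
    [:: 5; 10; 1; 12; 20]]]);
  ([:: [:: 0; 10; 26; 1; 11]; [:: 0; 15; 21; 1; 25]; [:: 0; 20; 15; 2; 26];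
    [:: 1; 12; 2; 22; 15]; [:: 2; 13; 26; 14; 25]; [:: 3; 13; 25; 12; 26];
    [:: 3; 14; 4; 15; 23]; [:: 3; 15; 24; 4; 25]; [:: 4; 10; 25; 11; 26]], [:: [::
    [:: 16; 0; 12; 3; 20]; [:: 0; 21; 2; 20; 13]]; [:: [:: 16; 0; 12; 3; 20]]; [::
    [:: 5; 10; 1; 13; 20]]; [:: [:: 5; 10; 20; 1; 22]]; [:: [:: 0; 12; 3; 11; 21]];
    [:: [:: 0; 21; 2; 20; 12]]]);
  ([:: [:: 0; 10; 21; 1; 15]; [:: 0; 20; 14; 4; 25]; [:: 1; 11; 5; 12; 25];
    [:: 2; 12; 23; 15; 22]; [:: 2; 15; 3; 13; 25]; [:: 3; 23; 5; 10; 25];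
    [:: 4; 15; 20; 5; 24]; [:: 5; 13; 24; 15; 21]; [:: 5; 14; 25; 11; 22]], [::
    [::]]);
  ([:: [:: 0; 10; 20; 4; 11]; [:: 0; 12; 2; 14; 20]; [:: 0; 21; 1; 12; 25];
    [:: 1; 11; 21; 10; 25]; [:: 1; 13; 23; 12; 22]; [:: 2; 13; 25; 11; 22];
    [:: 2; 23; 3; 14; 25]; [:: 3; 10; 4; 24; 13]; [:: 3; 24; 14; 4; 25]], [:: [::
    [:: 26; 0; 13; 20; 12]; [:: 0; 22; 4; 23; 14]]; [:: [:: 26; 0; 13; 20; 11]]; [::
    [:: 5; 10; 22; 0; 23]]; [:: [:: 0; 22; 3; 21; 13]]; [::]]);
  ([:: [:: 0; 10; 27; 1; 11]; [:: 0; 12; 25; 11; 27]; [:: 0; 25; 4; 11; 26];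
    [:: 1; 12; 27; 3; 25]; [:: 1; 13; 2; 12; 26]; [:: 2; 14; 25; 13; 27];
    [:: 2; 25; 10; 3; 26]; [:: 3; 13; 26; 4; 14]; [:: 4; 10; 26; 14; 27]], [:: [::
    [:: 28; 0; 13; 20; 10]; [:: 0; 20; 1; 22; 14]]]);
  ([:: [:: 0; 10; 4; 20; 15]; [:: 0; 11; 25; 1; 22]; [:: 0; 12; 25; 3; 20];
    [:: 0; 21; 4; 14; 25]; [:: 1; 11; 4; 25; 13]; [:: 1; 12; 2; 22; 15];
    [:: 1; 21; 15; 2; 23]; [:: 2; 13; 3; 10; 25]; [:: 2; 14; 3; 15; 24];
    [:: 3; 23; 15; 4; 24]], [:: [:: [:: 10; 20; 11; 24; 1]]; [::]; [::
    [:: 16; 0; 23; 10; 20]; [:: 10; 22; 11; 20; 1]]; [:: [:: 16; 0; 13; 4; 22]]; [::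
    [:: 5; 10; 1; 14; 20]]; [:: [:: 5; 10; 20; 11; 22]]]);
  ([:: [:: 0; 10; 27; 11; 26]; [:: 0; 11; 21; 1; 25]; [:: 0; 20; 10; 4; 27];
    [:: 1; 11; 25; 10; 26]; [:: 1; 12; 22; 2; 27]; [:: 2; 12; 27; 13; 25];
    [:: 2; 13; 23; 3; 26]; [:: 3; 13; 26; 14; 27]; [:: 3; 14; 24; 4; 25];
    [:: 4; 14; 25; 12; 26]], [:: [:: [:: 5; 10; 1; 13; 20]; [:: 10; 21; 12; 20; 2]];
    [:: [:: 28; 0; 12; 20; 11]; [:: 0; 21; 2; 20; 13]]; [:: [:: 5; 10; 1; 13; 20]]]);
  ([:: [:: 0; 10; 4; 26; 11]; [:: 0; 15; 22; 2; 26]; [:: 0; 20; 15; 3; 25];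
    [:: 0; 21; 15; 1; 22]; [:: 1; 11; 25; 10; 26]; [:: 1; 12; 26; 13; 25];
    [:: 1; 21; 4; 15; 23]; [:: 2; 12; 25; 4; 24]; [:: 2; 13; 3; 24; 15];
    [:: 2; 23; 3; 14; 25]; [:: 3; 20; 4; 14; 26]], [:: [:: [:: 27; 0; 12; 3; 11]]; [::
    [:: 16; 0; 12; 3; 21]]; [::]]);
  ([:: [:: 0; 10; 26; 1; 25]; [:: 0; 15; 1; 11; 26]; [:: 2; 12; 22; 11; 25];
    [:: 2; 15; 24; 14; 26]; [:: 3; 13; 5; 20; 15]; [:: 3; 25; 14; 4; 26];
    [:: 4; 15; 23; 12; 25]; [:: 5; 10; 25; 13; 24]; [:: 5; 11; 21; 15; 22];
    [:: 5; 12; 26; 13; 23]; [:: 5; 14; 20; 10; 21]], [:: [::]]);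
  ([:: [:: 0; 10; 26; 2; 25]; [:: 0; 11; 26; 14; 27]; [:: 0; 12; 23; 13; 26];
    [:: 1; 11; 22; 12; 27]; [:: 1; 12; 25; 3; 26]; [:: 1; 13; 3; 10; 25];
    [:: 2; 12; 26; 4; 14]; [:: 2; 13; 25; 11; 27]; [:: 3; 14; 24; 13; 27];
    [:: 4; 10; 20; 14; 25]; [:: 4; 11; 21; 10; 27]], [:: [:: [:: 28; 0; 13; 20; 11];
    [:: 0; 20; 1; 22; 14]]]);
  ([:: [:: 0; 10; 4; 14; 25]; [:: 0; 11; 1; 15; 20]; [:: 0; 15; 24; 4; 16];
    [:: 0; 21; 1; 12; 26]; [:: 1; 16; 2; 15; 22]; [:: 1; 25; 2; 13; 26];
    [:: 2; 12; 25; 10; 26]; [:: 2; 22; 16; 3; 23]; [:: 3; 13; 25; 4; 26];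
    [:: 3; 14; 26; 11; 25]; [:: 3; 15; 21; 16; 24]; [:: 4; 15; 23; 16; 20]], [:: [::
    [:: 10; 20; 11; 22; 3]]; [::]; [:: [:: 5; 10; 1; 13; 20]; [:: 0; 22; 3; 21; 13]];
    [:: [:: 5; 10; 1; 13; 20]; [:: 10; 20; 11; 24; 2]]; [:: [:: 17; 0; 12; 3; 20]];
    [:: [:: 5; 10; 1; 13; 20]]; [:: [:: 5; 10; 20; 11; 22]]]);
  ([:: [:: 0; 10; 26; 12; 25]; [:: 0; 11; 21; 1; 15]; [:: 0; 20; 5; 14; 26];
    [:: 1; 11; 25; 2; 12]; [:: 1; 25; 13; 3; 26]; [:: 2; 13; 5; 12; 22];
    [:: 2; 15; 23; 13; 26]; [:: 3; 14; 4; 10; 25]; [:: 3; 15; 22; 5; 23];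
    [:: 4; 15; 24; 14; 25]; [:: 4; 24; 5; 11; 26]; [:: 5; 10; 20; 15; 21]], [::
    [::]]);
  ([:: [:: 0; 10; 27; 1; 25]; [:: 0; 11; 1; 14; 27]; [:: 0; 12; 22; 2; 26];
    [:: 0; 13; 2; 10; 20]; [:: 1; 12; 26; 11; 21]; [:: 1; 13; 27; 3; 26];
    [:: 2; 12; 27; 4; 25]; [:: 2; 14; 25; 11; 27]; [:: 3; 10; 25; 13; 23];
    [:: 3; 11; 4; 26; 13]; [:: 3; 14; 4; 12; 25]; [:: 4; 10; 26; 14; 24]], [:: [::
    [:: 5; 10; 21; 0; 22]; [:: 10; 23; 11; 20; 1]]; [:: [:: 28; 0; 14; 20; 11]]; [::
    [:: 5; 10; 21; 12; 20]]; [:: [:: 5; 10; 21; 0; 22]]]);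
  ([:: [:: 0; 10; 4; 21; 13]; [:: 0; 11; 24; 2; 20]; [:: 0; 12; 2; 10; 23];
    [:: 0; 21; 3; 11; 22]; [:: 1; 11; 21; 14; 24]; [:: 1; 12; 20; 10; 21];
    [:: 1; 13; 3; 14; 22]; [:: 1; 14; 4; 11; 23]; [:: 2; 13; 24; 4; 22];
    [:: 2; 14; 20; 13; 23]; [:: 3; 10; 22; 12; 23]; [:: 3; 20; 4; 12; 24]], [::
    [::]]);
  ([:: [:: 0; 10; 26; 12; 25]; [:: 0; 15; 20; 4; 27]; [:: 0; 16; 23; 15; 21];
    [:: 0; 20; 16; 2; 26]; [:: 1; 11; 26; 14; 27]; [:: 1; 15; 4; 16; 21];
    [:: 1; 16; 24; 4; 25]; [:: 1; 22; 15; 3; 26]; [:: 2; 12; 27; 11; 25];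
    [:: 2; 15; 24; 3; 27]; [:: 2; 22; 16; 3; 23]; [:: 3; 13; 27; 10; 25];
    [:: 4; 14; 25; 13; 26]], [:: [:: [:: 17; 0; 11; 2; 20]; [:: 10; 20; 11; 22; 3]];
    [:: [:: 17; 0; 11; 2; 20]]; [:: [:: 5; 10; 1; 12; 20]]]);
  ([:: [:: 0; 10; 20; 13; 27]; [:: 0; 11; 23; 12; 26]; [:: 0; 12; 2; 14; 25];
    [:: 1; 11; 25; 10; 27]; [:: 1; 12; 20; 14; 26]; [:: 1; 13; 26; 2; 25];
    [:: 2; 13; 21; 11; 27]; [:: 3; 10; 22; 12; 27]; [:: 3; 13; 23; 10; 26];
    [:: 3; 14; 24; 12; 25]; [:: 4; 10; 21; 14; 27]; [:: 4; 11; 24; 13; 25];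
    [:: 4; 14; 22; 11; 26]], [:: [:: [:: 28; 0; 20; 1; 10]; [:: 0; 21; 4; 22; 13]];
    [:: [:: 5; 10; 1; 14; 23]]; [:: [:: 28; 0; 20; 1; 10]]; [::
    [:: 0; 20; 1; 22; 13]]; [::]]);
  ([:: [:: 0; 10; 25; 2; 24]; [:: 0; 11; 29; 10; 26]; [:: 0; 12; 25; 1; 23];
    [:: 0; 15; 24; 1; 27]; [:: 0; 20; 3; 14; 28]; [:: 0; 21; 15; 2; 22];
    [:: 0; 25; 11; 1; 29]; [:: 1; 12; 27; 3; 22]; [:: 1; 13; 25; 4; 20];
    [:: 1; 15; 20; 2; 28]; [:: 1; 21; 4; 11; 26]; [:: 2; 12; 29; 13; 26];
    [:: 2; 13; 28; 11; 27]; [:: 2; 14; 29; 3; 21]; [:: 2; 23; 15; 4; 29];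
    [:: 3; 10; 27; 14; 25]; [:: 3; 13; 27; 4; 26]; [:: 3; 15; 22; 4; 24];
    [:: 3; 23; 4; 10; 28]; [:: 4; 14; 26; 12; 28]], [:: [::]]);
  ([:: [:: 0; 10; 4; 15; 24]; [:: 0; 11; 2; 20; 15]; [:: 0; 12; 1; 14; 25];
    [:: 0; 13; 3; 26; 14]; [:: 0; 16; 24; 17; 21]; [:: 0; 17; 23; 3; 20];
    [:: 0; 22; 4; 11; 26]; [:: 0; 23; 4; 12; 27]; [:: 1; 10; 2; 22; 15];
    [:: 1; 11; 27; 13; 25]; [:: 1; 13; 26; 4; 20]; [:: 1; 16; 3; 12; 26];
    [:: 1; 17; 20; 16; 21]; [:: 1; 22; 17; 2; 27]; [:: 1; 23; 15; 3; 24];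
    [:: 2; 12; 25; 10; 26]; [:: 2; 13; 4; 21; 15]; [:: 2; 14; 27; 3; 21];
    [:: 2; 16; 22; 3; 25]; [:: 2; 23; 16; 4; 24]; [:: 3; 10; 27; 4; 14];
    [:: 3; 11; 25; 4; 17]], [:: [::]]);
  ([:: [:: 0; 10; 29; 13; 27]; [:: 0; 11; 26; 2; 15]; [:: 0; 12; 27; 4; 29];
    [:: 0; 16; 23; 15; 21]; [:: 0; 17; 21; 3; 24]; [:: 0; 20; 15; 3; 25];
    [:: 0; 22; 16; 3; 28]; [:: 0; 23; 2; 12; 26]; [:: 1; 11; 29; 12; 28];
    [:: 1; 12; 25; 10; 26]; [:: 1; 13; 3; 20; 16]; [:: 1; 15; 22; 17; 23];
    [:: 1; 17; 24; 4; 22]; [:: 1; 20; 4; 16; 21]; [:: 1; 24; 16; 2; 27];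
    [:: 1; 25; 13; 2; 29]; [:: 2; 14; 27; 3; 22]; [:: 2; 17; 3; 14; 28];
    [:: 2; 20; 17; 4; 25]; [:: 2; 21; 4; 15; 24]; [:: 3; 10; 28; 13; 26];
    [:: 3; 23; 4; 14; 29]; [:: 4; 10; 27; 11; 28]; [:: 4; 11; 25; 14; 26]], [::
    [::]])].

Definition table : seq (seq label_cycle * seq label_cycle) :=
  flatten [seq [seq (map (map decode) r.1, map (map decode) s) | s <- r.2] | r <- rows].

(** That is, [c - d] is less than twice the harmonic mean of [a + 1] and [b + 1].  The
    [d] accounts for rounding: [a], [b], [c] are shares of the part sizes, rounded
    down for [d = 0] and in either direction for [d = 1]. *)
Definition mean (d a b c : nat) : bool :=
  (c - d) * (a + b + 2) < 4 * (a.+1 * b.+1).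

Definition balanced (d a b c : nat) : bool :=
  [&& mean d a b c, mean d a c b & mean d b c a].

(** Old vertices come in pairs, apart from at most [e] in each class, hence the sizes
    [2 a + e].  It suffices to have each triple of sizes in some order, by
    [cell_decomposes_perm]. *)
Definition covers (d e m : nat) (ss : seq (seq nat)) : bool :=
  all (fun a => all (fun b => all (fun c =>
    balanced d a b c ==> has (perm_eq [:: 2 * a + e; 2 * b + e; 2 * c + e]) ss)
  (iota 0 m)) (iota 0 m)) (iota 0 m).

Definition checked_sizes (f : bool) : seq (seq nat) :=
  [seq cell_sizes f r | r <- table & checks (cell_sizes f r) f (cell_cycles f r)].

Lemma coversP d e m f : covers d e m (checked_sizes f) ->
  forall a b c, a < m -> b < m -> c < m -> balanced d a b c ->
  cell_decomposes [:: 2 * a + e; 2 * b + e; 2 * c + e] f.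
Proof.
move=> /allP cov a b c am bm cm bal.
have /cov /allP /(_ b)/(_ _)/allP /(_ c) : a \in iota 0 m by rewrite mem_iota.
rewrite !mem_iota bm cm bal => /(_ isT isT) /= /hasP[s /mapP[r]].
rewrite mem_filter => /andP[ok _] -> perm_s.
by apply: cell_decomposes_perm perm_s (checks_cell_decomposes ok).
Qed.

Lemma covers_even : covers 1 0 6 (checked_sizes false).
Proof. by vm_cast_no_check (erefl true). Qed.

Lemma covers_odd : covers 0 1 5 (checked_sizes false).
Proof. by vm_cast_no_check (erefl true). Qed.

Lemma covers_apex : covers 1 0 4 (checked_sizes true).
Proof. by vm_cast_no_check (erefl true). Qed.

(** * Cells from the Latin square [k = i + j] *)

Lemma sum_pred1 (I : finType) (P : pred I) i0 :
  P =1 pred1 i0 -> \sum_i (P i : nat) = 1.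
Proof.
move=> eP; rewrite (bigD1 i0) //= eP /= eqxx big1 // => i /negPf ni.
by rewrite eP /= ni.
Qed.

Lemma card_ord_lt m n : n <= m -> #|[pred i : 'I_m | i < n]| = n.
Proof.
move=> nm; rewrite -sum1_card (big_ord_narrow nm) big_const_ord.
by rewrite iter_addn_0 mul1n.
Qed.

Section Cells.
Variable q' : nat.
Local Notation q := q'.+1.
Local Notation G := 'I_q.
Local Notation cell := (G * G)%type.

Definition block (k : cell) (c : nat) : G :=
  match c with 0 => k.1 | 1 => k.2 | _ => (k.1 + k.2)%R end.

(** The Latin square property: two blocks in different classes lie in exactly one common
    cell. *)
Lemma block_pair (c c' : nat) (g g' : G) : c < 3 -> c' < 3 -> c != c' ->
  \sum_k ((block k c == g) && (block k c' == g')) = 1.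
Proof.
suff sym (d d' : nat) (x x' : G) : d < d' -> d' < 3 ->
    \sum_k ((block k d == x) && (block k d' == x')) = 1.
  move=> c3 c'3; rewrite neq_ltn => /orP[] lt_c; first exact: sym.
  rewrite -(sym _ _ g' g lt_c c3); apply: eq_bigr => k _; by rewrite andbC.
case: d d' => [|[|d]] [|[|[|//]]] // _ _; rewrite /block /=.
- by apply: (@sum_pred1 _ _ (x, x')) => -[i j] /=; rewrite xpair_eqE.
- apply: (@sum_pred1 _ _ (x, (x' - x)%R)) => -[i j] /=; rewrite xpair_eqE.
  by have [->|//] := eqVneq i x; rewrite [RHS]eq_sym subr_eq addrC eq_sym.
- apply: (@sum_pred1 _ _ ((x' - x)%R, x)) => -[i j] /=; rewrite xpair_eqE [RHS]andbC.
  by have [->|//] := eqVneq j x; rewrite [RHS]eq_sym subr_eq eq_sym.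
Qed.

Definition slope (k : cell) : G := (k.2 - k.1)%R.

Lemma double_inj : odd q -> injective (fun x : G => x + x)%R.
Proof.
move=> odd_q x y /eqP; rewrite -subr_eq0 opprD addrACA => /eqP /(congr1 val) /=.
set z := (x - y)%R => /eqP zz; apply/eqP; rewrite -subr_eq0 -/z; apply/eqP/val_inj.
move: zz; rewrite -/(dvdn q (z + z)) addnn -muln2 Gauss_dvdl ?coprimen2 //.
by rewrite /dvdn modn_small ?ltn_ord // => /eqP.
Qed.

(** For odd [q] the cells of a fixed slope form a transversal of the Latin square; class
    2 needs the equation [2 i + d = g] to be uniquely solvable in [i]. *)
Lemma block_slope (c : nat) (g d : G) : odd q -> c < 3 ->
  \sum_k ((block k c == g) && (slope k == d)) = 1.
Proof.
move=> odd_q; case: c => [|[|[|//]]] _; rewrite /block /slope /=.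
- apply: (@sum_pred1 _ _ (g, (g + d)%R)) => -[i j] /=; rewrite xpair_eqE.
  by have [->|//] := eqVneq i g; rewrite subr_eq addrC.
- apply: (@sum_pred1 _ _ ((g - d)%R, g)) => -[i j] /=; rewrite xpair_eqE [RHS]andbC.
  by have [->|//] := eqVneq j g; rewrite subr_eq addrC -subr_eq eq_sym.
have [half _ halfK] := injF_bij (double_inj odd_q).
pose i0 := half (g - d)%R; have i0P : (i0 + i0 = g - d)%R by exact: halfK.
apply: (@sum_pred1 _ _ (i0, (i0 + d)%R)) => -[i j] /=; rewrite xpair_eqE.
apply/andP/andP => [[/eqP e1 /eqP e2]|[/eqP-> /eqP->]].
  have ej : (j = i + d)%R by rewrite -e2 addrC subrK.
  have ei : i = i0.
    by apply: (double_inj odd_q); rewrite i0P -e1 ej addrA addrK.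
  by rewrite ej ei !eqxx.
by rewrite addrA i0P subrK [(i0 + d)%R]addrC addrK !eqxx.
Qed.

(** The diagonal cells [(e, e)] with [e < q / 2] use the blocks [e], [e] and [2 e].  With
    the partner blocks [e + q / 2], [e + q / 2] and [2 e + 1] they exhaust all blocks,
    and [half_index] recovers [e] from either block. *)
Definition diagonal (k : cell) : bool := (k.1 == k.2) && (k.1 < q./2).

Definition half_index (c : nat) (g : G) : nat :=
  if c < 2 then g %% q./2 else g./2.

Lemma half_index_block k c : ~~ odd q -> diagonal k ->
  half_index c (block k c) = k.1.
Proof.
case: k => i j ev_q /andP[/= /eqP<- lt_i]; rewrite /half_index /block.
case: c => [|[|c]] /=; rewrite ?modn_small //; lia.
Qed.

Lemma diagonal_half_index c g : ~~ odd q ->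
  \sum_k (diagonal k && (half_index c g == k.1)) = 1.
Proof.
move=> ev_q; have q2 : 0 < q./2 by lia.
have lt_e : half_index c g < q./2.
  rewrite /half_index; case: ifP => _; first by rewrite ltn_mod.
  have := ltn_ord g; lia.
have lt_eq : half_index c g < q by lia.
apply: (@sum_pred1 _ _ (inord (half_index c g), inord (half_index c g))).
move=> [i j]; rewrite /diagonal /= xpair_eqE.
apply/andP/andP => [[/andP[/eqP<- lt_i] /eqP->]|[/eqP-> /eqP->]].
  by rewrite inord_val.
by rewrite eqxx inordK // lt_e eqxx.
Qed.

End Cells.

(** An attachment of old vertices to cells.  The old vertices of class [c] and index [g]
    number [a c g], and those of index [home k c] are attached to the cell [k].  The flag
    [apex] adds one more old vertex to each class. *)
Section Scheme.
Variables (q' : nat).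
Local Notation q := q'.+1.
Local Notation G := 'I_q.
Local Notation cell := (G * G)%type.
Variables (a : nat -> G -> nat) (apex : bool) (home : cell -> nat -> G).
Hypothesis block_home : forall (c c' : nat) (g d : G), c < 3 -> c' < 3 -> c != c' ->
  \sum_k ((block k c == g) && (home k c' == d)) = 1.
Hypothesis a_le : forall c g, a c g <= 10.
Hypothesis apex_even : apex -> ~~ odd q.
Hypothesis cells : forall k : cell,
  cell_decomposes [:: a 0 (home k 0); a 1 (home k 1); a 2 (home k 2)]
                  (apex && diagonal k).

(** A vertex is a class, an index in [Z_q], and either a position in the block with that
    index or the rank of an old vertex with that index.  Ranks below [a c g] are ordinary
    old vertices; the rank 10, which no ordinary old vertex has, is the apex if the index
    is 0; all other triples are unused. *)
Definition vertex := ('I_3 * G * ('I_5 + 'I_11))%type.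

Definition is_apex (x : vertex) : bool :=
  match x with
  | (c, g, inl _) => false
  | (c, g, inr l) => [&& apex, g == ord0 & l == 10 :> nat]
  end.

Definition kind (k : cell) (x : vertex) : nat :=
  match x with
  | (c, g, inl _) => if block k c == g then 0 else
      if [&& apex, diagonal k & half_index c g == k.1] then 2 else 4
  | (c, g, inr l) => if (l < a c g) && (home k c == g) then 1 else
      if is_apex x && diagonal k then 3 else 4
  end.

(** Kinds without reference to a cell: 0 is new, 1 is old, and 4 is unused. *)
Definition global_kind (x : vertex) : nat :=
  match x with
  | (c, g, inl _) => 0
  | (c, g, inr l) => if (l < a c g) || is_apex x then 1 else 4
  end.

Definition typed (K : vertex -> nat) (x : vertex) : nat * nat :=
  (x.1.1 : nat, K x).

(** Each edge with a new end lies in exactly one cell: two new vertices by the Latin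
    square property, a new and an ordinary old vertex by the hypothesis on [home], and a
    new vertex and an apex because the diagonal cells and their partner blocks exhaust
    all blocks. *)
Lemma sum_joined_kind x y :
  \sum_k joined (typed (kind k) x) (typed (kind k) y) =
  joined (typed global_kind x) (typed global_kind y).
Proof.
case: x y => [[c g] z] [[c' g'] z'].
rewrite /joined /= !ltn_ord /=; case: (eqVneq c c') => [->|nc] /=.
  by rewrite eqxx big1.
have nc' : (c != c' :> nat) by [].
rewrite nc' /=.
suff mixed (d d' : 'I_3) (h h' : G) (l : 'I_5) (l' : 'I_11) : d != d' ->
    \sum_k linked (kind k (d, h, inl l)) (kind k (d', h', inr l')) =
    linked 0 (global_kind (d', h', inr l')).
  case: z z' => [l|l] [l'|l'].
  - rewrite -[RHS](block_pair g g' (ltn_ord c) (ltn_ord c') nc').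
    by apply: eq_bigr => k _ /=; do 2 case: eqP => //= _; do ?case: ifP.
  - exact: mixed.
  - transitivity (\sum_k linked (kind k (c', g', inl l')) (kind k (c, g, inr l))).
      by apply: eq_bigr => k _; rewrite linkedC.
    by rewrite mixed; [rewrite linkedC | rewrite eq_sym].
  - rewrite big1 => [|k _] /=; first by do 2 case: ifP.
    by do 2 (case: ifP => _; [|case: ifP => _]).
move=> {nc nc'} nd; have nd' : (d != d' :> nat) by []. rewrite /=.
have [lt_l|ge_l] /= := ltnP l' (a d' h').
  have -> : (l' == 10 :> nat) = false by have := a_le d' h'; lia.
  rewrite -[RHS](block_home h h' (ltn_ord d) (ltn_ord d') nd').
  apply: eq_bigr => k _; rewrite !andbF /=.
  by do 2 case: eqP => //= _; do ?case: ifP.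
case ap: [&& _, _ & _] => /=; last first.
  by rewrite big1 // => k _; do ?case: ifP.
have a1 : apex by case/and3P: ap.
rewrite a1 -[RHS](diagonal_half_index d h (apex_even a1)); apply: eq_bigr => k _ /=.
case: (boolP (diagonal k)) => [dk|_] /=; last by do ?case: ifP.
case: eqP => [<-|_]; first by rewrite half_index_block ?apex_even // eqxx.
by case: eqP.
Qed.

Lemma card_vertex (c : 'I_3) (g : G) (P : pred ('I_5 + 'I_11)) :
  #|[pred x : vertex | [&& x.1.1 == c, x.1.2 == g & P x.2]]| = #|P|.
Proof.
have inj : injective (fun z : 'I_5 + 'I_11 => (c, g, z)) by move=> z z' [].
rewrite -(card_image inj P); apply: eq_card => -[[c' g'] z]; rewrite !inE /=.
apply/and3P/imageP => [[/eqP-> /eqP-> Pz]|[z' Pz' [-> -> ->]]]; last by split.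
by exists z.
Qed.

Definition on_new : pred ('I_5 + 'I_11) :=
  fun z => if z is inl _ then true else false.

Definition on_old (P : pred 'I_11) : pred ('I_5 + 'I_11) :=
  fun z => if z is inr l then P l else false.

Lemma card_inl : #|on_new| = 5.
Proof.
rewrite -[RHS]card_ord -(card_image (@inl_inj 'I_5 'I_11)); apply: eq_card => -[l|l].
  by rewrite unfold_in /=; apply/esym/imageP; exists l.
by rewrite unfold_in /=; apply/esym/imageP => -[].
Qed.

Lemma card_inr (P : pred 'I_11) :
  #|on_old P| = #|P|.
Proof.
rewrite -(card_image (@inr_inj 'I_5 'I_11) P); apply: eq_card => -[l|l].
  by rewrite unfold_in /=; apply/esym/imageP => -[].
by rewrite unfold_in /=; apply/idP/imageP => [Pl|[l' Pl' [->]]] //; exists l.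
Qed.

(** A diagonal cell has exactly one partner block in each class, so it has the vertex
    counts that [profile] asks for. *)
Lemma diagonal_partner k c : ~~ odd q -> diagonal k -> c < 3 ->
  exists g0 : G, forall g,
    (block k c != g) && (half_index c g == k.1) = (g == g0).
Proof.
case: k => i j ev_q /andP[/= /eqP<- lt_i]; rewrite /half_index /block.
have vE (g h : G) : (g == h) = (g == h :> nat) by [].
have ltq (g : G) := ltn_ord g.
case: c => [|[|[|//]]] _ /=.
1,2: exists (inord (i + q./2)) => g; rewrite !vE inordK; last lia;
  have := ltq g; case: (ltnP g q./2) => [gm|gm] gq;
  [rewrite modn_small // | rewrite -[g in g %% _](subnK gm) modnDr modn_small]; lia.
exists (inord (i + i).+1) => g; rewrite !vE inordK; last lia.
have := ltq g; rewrite /= modn_small; lia.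
Qed.

Lemma decomposes_outside_old :
  decomposes (fun x y => joined (typed global_kind x) (typed global_kind y)).
Proof.
apply: eq_decomposes sum_joined_kind _; apply: decomposes_sum => k.
apply: (@cells k).
case=> c m /andP[/= c3 m4]; pose c' := Ordinal c3.
have typedE x : (typed (kind k) x == (c, m)) = (x.1.1 == c') && (kind k x == m).
  by rewrite /typed xpair_eqE.
rewrite (eq_card (B := [pred x | (x.1.1 == c') && (kind k x == m)])); last first.
  by move=> x; rewrite !inE typedE.
case: m m4 {typedE} => [|[|[|[|//]]]] _; rewrite /profile.
- rewrite (eq_card (B := [pred x : vertex | [&& x.1.1 == c', x.1.2 == block k c' & on_new x.2]]));
    first by rewrite card_vertex card_inl.
  move=> [[d g] z]; rewrite !inE /=; case: eqP => //= ->.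
  case: z => l; first by rewrite [g == _]eq_sym; case: (_ == g) => //=; case: ifP.
  by rewrite andbF; case: ifP => // _; case: ifP.
- have -> : nth 0 [:: a 0 (home k 0); a 1 (home k 1); a 2 (home k 2)] (c, 1).1 = a c (home k c).
    by case: c c3 {c'} => [|[|[|//]]].
  have le11 : a c (home k c) <= 11 by apply: leqW; apply: a_le.
  rewrite (eq_card (B := [pred x : vertex | [&& x.1.1 == c', x.1.2 == home k c &
      on_old (fun l => l < a c (home k c)) x.2]])).
    by rewrite card_vertex card_inr card_ord_lt.
  move=> [[d g] z]; rewrite !inE /=; case: eqP => //= ->.
  case: z => l; first by rewrite andbF; case: ifP => // _; case: ifP.
  rewrite [g == _]eq_sym; have [<-|_] := eqVneq (home k c) g; rewrite ?andbT ?andbF /=.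
    by case: (l < _) => //; case: ifP.
  by case: ifP.
- case E: (apex && diagonal k); last first.
    apply: eq_card0 => -[[d g] z]; rewrite !inE /=; apply/andP => -[_].
    by rewrite andbA E; case: z => l; do ?case: ifP.
  have /andP[a1 dk] := E.
  have [g0 g0P] := diagonal_partner (apex_even a1) dk c3.
  rewrite (eq_card (B := [pred x : vertex | [&& x.1.1 == c', x.1.2 == g0 & on_new x.2]]));
    first by rewrite card_vertex card_inl //= mul1n.
  move=> [[d g] z]; rewrite !inE /=; case: eqP => //= ->.
  rewrite andbA E -g0P; case: z => l.
    by rewrite andbT /=; have [_|_] := eqVneq (block k c) g => //=; case: ifP.
  by rewrite andbF; do ?case: ifP.
- rewrite (eq_card (B := [pred x : vertex | [&& x.1.1 == c', x.1.2 == ord0 &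
      on_old (fun l => [&& apex, diagonal k & l == 10 :> nat]) x.2]])).
    rewrite card_vertex card_inr; case: (boolP (apex && diagonal k)) => [|nk] /=.
      by case/andP=> -> ->; rewrite (eq_card (B := pred1 (ord_max : 'I_11))) ?card1.
    by apply: eq_card0 => l; rewrite unfold_in /= andbA (negPf nk).
  move=> [[d g] z]; rewrite !inE /=; case: eqP => //= ->.
  case: z => l; first by rewrite andbF; do ?case: ifP.
  rewrite /on_old /=; have := a_le c' g; case: (l =P 10 :> nat) => [->|_] le_a.
    rewrite ltnNge le_a /= !andbT.
    by case: apex; case: (g == ord0); case: (diagonal k).
  by rewrite !andbF; case: ifP.
Qed.

Lemma card_class (P : G -> pred ('I_5 + 'I_11)) (c : 'I_3) :
  #|[pred x : vertex | (x.1.1 == c) && P x.1.2 x.2]| = \sum_g #|P g|.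
Proof.
rewrite -sum1_card (partition_big (fun x : vertex => x.1.2) xpredT) //=.
apply: eq_bigr => g _; rewrite -(card_vertex c g) -sum1_card; apply: eq_bigl.
move=> x; rewrite !inE -andbA; congr (_ && _); rewrite andbC.
by case: eqP => // ->.
Qed.

Definition cross_class (s t : nat) : bool := [&& s < 3, t < 3 & s != t].

Definition old_class (x : vertex) : nat :=
  if global_kind x == 1 then nat_of_ord x.1.1 else 3.

Definition any_class (x : vertex) : nat :=
  if global_kind x < 4 then nat_of_ord x.1.1 else 3.

Lemma card_old g (c : 'I_3) :
  #|[pred z : 'I_5 + 'I_11 | global_kind (c, g, z) == 1]| =
  a c g + (apex && (g == ord0)).
Proof.
pose P := [pred l : 'I_11 | (l < a c g) || [&& apex, g == ord0 & l == 10 :> nat]].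
rewrite (eq_card (B := on_old P)); last first.
  by move=> [l|l]; rewrite unfold_in [RHS]unfold_in //=; case: ifP.
rewrite card_inr.
have le11 : a c g <= 11 by apply: leqW; apply: a_le.
case E: (apex && (g == ord0)).
  rewrite (eq_card (B := predU1 (ord_max : 'I_11) [pred l : 'I_11 | l < a c g])).
    by rewrite cardU1 card_ord_lt // unfold_in /= -leqNgt a_le addnC.
  by move=> l; rewrite !inE andbA E orbC.
rewrite addn0 -(card_ord_lt le11); apply: eq_card => l.
by rewrite !inE andbA E orbF.
Qed.

Lemma card_old_class (c : 'I_3) :
  #|[pred x | old_class x == c]| = \sum_g a c g + apex.
Proof.
pose P g := [pred z : 'I_5 + 'I_11 | global_kind (c, g, z) == 1].
have apexE : apex = \sum_(g : G) (apex && (g == ord0)) :> nat.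
  rewrite (bigD1 ord0) //= eqxx andbT big1 ?addn0 // => g /negPf->.
  by rewrite andbF.
rewrite (eq_card (B := [pred x : vertex | (x.1.1 == c) && P x.1.2 x.2])).
  rewrite (card_class P) apexE -big_split /=.
  by apply: eq_bigr => g _; apply: card_old.
case=> -[d g] z; rewrite !inE /old_class /=.
case: (eqVneq d c) => [->|nd]; first by case: ifP; rewrite ?eqxx // => _; case: c {P}=> -[|[|[|]]].
by case: ifP => _; [apply: negPf | case: c {P nd} => -[|[|[|]]]].
Qed.

Lemma card_any_class (c : 'I_3) :
  #|[pred x | any_class x == c]| = 5 * q + (\sum_g a c g + apex).
Proof.
rewrite -card_old_class -(cardID [pred x : vertex | on_new x.2]).
congr (_ + _).
  rewrite (eq_card (B := [pred x : vertex | (x.1.1 == c) && on_new x.2])).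
    by rewrite (card_class (fun=> on_new)) sum_nat_const card_inl card_ord mulnC.
  by move=> [[d g] [l|l]]; rewrite !inE /= ?andbT ?andbF.
apply: eq_card => -[[d g] [l|l]]; rewrite !inE /= /any_class /old_class /=.
  by case: c => -[|[|[|]]].
by case: (_ || _); rewrite ?andbT.
Qed.

(** Adding the old-old edges completes the tripartite graph on all vertices. *)
Lemma decomposes_extend :
  decomposes (fun x y => cross_class (old_class x) (old_class y)) ->
  decomposes (fun x y => cross_class (any_class x) (any_class y)).
Proof.
move=> dec_old; apply: eq_decomposes (decomposesD decomposes_outside_old dec_old) => x y.
rewrite /joined /typed /cross_class /old_class /any_class /= !ltn_ord /=.
move: x y => [[c g] z] [[c' g'] z'] /=.
have le3 (d : 'I_3) : d < 3 := ltn_ord d.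
case: z => l; case: z' => l' /=; do ?(case: ifP => _ /=);
  rewrite ?le3 ?andbF ?andbT ?addn0 //=.
Qed.

End Scheme.

(** * The extension theorem *)

Lemma complete_tripartiteE r s t x y :
  complete_tripartite r s t x y =
  cross_class (tripartite_part x) (tripartite_part y).
Proof.
by case: x y => [[x|x]|x] [[y|y]|y].
Qed.

Lemma card_tripartite_part r s t c : c < 3 ->
  #|[pred x : 'I_r + 'I_s + 'I_t | tripartite_part x == c]| = nth 0 [:: r; s; t] c.
Proof.
move=> c3; rewrite -sum1_card !big_mkcond !big_sumType /=.
by case: c c3 => [|[|[|//]]] _ /=; rewrite !sum_nat_const !card_ord !muln0 ?muln1 ?addn0.
Qed.

Lemma complete_tripartite_sym r s t : symmetric (complete_tripartite r s t).
Proof. by move=> x y; rewrite /complete_tripartite eq_sym. Qed.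

Lemma complete_tripartite_irr r s t : irreflexive (complete_tripartite r s t).
Proof. by move=> x; rewrite /complete_tripartite eqxx. Qed.

Lemma cross_class_lt3 c c' : cross_class c c' -> (c < 3) && (c' < 3).
Proof. by case/and3P=> -> ->. Qed.

(** The parities come from the degrees of a vertex of class 0 and one of class 1.  If
    there are [m] cycles, then [5 m = r s + r t + s t] and [m <= r s] combine to
    [t (r + s) <= 4 r s]. *)
Lemma tripartite_necessary r s t : 0 < r -> 0 < s ->
  cycle_decomposable 5 (complete_tripartite r s t) ->
  [/\ odd s = odd r, odd t = odd r, t * (r + s) <= 4 * (r * s),
      s * (r + t) <= 4 * (r * t) & r * (s + t) <= 4 * (s * t)].
Proof.
move=> r0 s0 /(cycle_decomposable_decomposes (@complete_tripartite_sym _ _ _)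
  (@complete_tripartite_irr _ _ _)) dec_rst.
have sumE c : c < 3 ->
    \sum_(x : 'I_r + 'I_s + 'I_t) (tripartite_part x == c) = nth 0 [:: r; s; t] c.
  move=> c3; rewrite -card_tripartite_part // -sum1_card [RHS]big_mkcond.
  by apply: eq_bigr => x _; rewrite inE; case: eqP.
have part3 (x : 'I_r + 'I_s + 'I_t) : tripartite_part x < 3 by case: x => [[]|].
have deg (x : 'I_r + 'I_s + 'I_t) : \sum_y complete_tripartite r s t x y =
    \sum_(c < 3 | c != tripartite_part x :> nat) nth 0 [:: r; s; t] c.
  under [RHS]eq_bigr => c _ do rewrite -sumE //.
  rewrite exchange_big; apply: eq_bigr => y _ /=; rewrite /complete_tripartite.
  rewrite big_mkcond (bigD1 (Ordinal (part3 y))) //= eqxx big1 => [|c].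
    by rewrite addn0 eq_sym; case: (_ != _).
  by rewrite -val_eqE /= eq_sym => /negPf->; case: ifP.
have := decomposes_even_degree (inl (inl (Ordinal r0))) dec_rst.
have := decomposes_even_degree (inl (inr (Ordinal s0))) dec_rst.
rewrite !deg big_mkcond !big_ord_recl big_ord0 /= => odd1.
rewrite big_mkcond !big_ord_recl big_ord0 /= => odd0.
have [|m [eq_m m01 m02 m12]] := @tripartite_cycle_count _ _ (nth 0 [:: r; s; t]) part3 _ dec_rst.
  move=> c; case: (ltnP c 3) => [/sumE //|c3]; rewrite nth_default // big1 // => x _.
  by have := part3 x; case: eqP => // ->; lia.
rewrite /= in eq_m m01 m02 m12; split; lia.
Qed.

(** Hermite's identity.  It shows that giving [(h + g) / q] pairs to the index [g]
    distributes exactly [h] pairs. *)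
Lemma sum_floor q h : \sum_(g < q.+1) (h + g) %/ q.+1 = h.
Proof.
elim: h => [|h IHh].
  by rewrite big1 // => g _; rewrite divn_small // add0n.
rewrite big_ord_recr /= addSnnS divnDr // divnn /=.
rewrite -{3}IHh big_ord_recl /= addn0.
under eq_bigr => g _ do rewrite addSnnS.
by rewrite addn1 addnS addnC.
Qed.

(** The hypothesis bounds [n3 / 2] by the harmonic mean of [n1] and [n2], which increases
    with both; replacing [n1], [n2] and [n3] by their bounds and cancelling [q] gives the
    claim. *)
Lemma harmonic_mean_lt q n1 n2 n3 a b c : 0 < n1 ->
  n1 < 2 * (q * a) -> n2 < 2 * (q * b) -> 2 * (q * c) < n3 ->
  n3 * (n1 + n2) <= 4 * (n1 * n2) -> c * (a + b) < 4 * (a * b).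
Proof.
move=> n1_gt0 lt1 lt2 lt3 le4.
have q_gt0 : 0 < q by case: q lt1 {lt2 lt3}.
have lt_c : 2 * (q * c) * (n1 + n2) < 4 * (n1 * n2).
  by apply: leq_trans le4; rewrite ltn_pmul2r; lia.
have le_a : n1 * (2 * (q * b)) * n2 <= 2 * (q * a) * (2 * (q * b)) * n2.
  by rewrite !leq_mul2r; apply/orP; right; apply/orP; right; apply: ltnW.
have le_b : 2 * (q * a) * n2 * n1 <= 2 * (q * a) * (2 * (q * b)) * n1.
  by rewrite leq_mul2r leq_mul2l (ltnW lt2) !orbT.
set x := 2 * (q * a) in lt1 le_a le_b *; set y := 2 * (q * b) in lt2 le_a le_b *.
(* Monotonicity of the harmonic mean, with denominators cleared. *)
have lt_xy : 2 * (q * c) * (n1 + n2) * (x + y) < 4 * (x * y) * (n1 + n2).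
  apply: (@leq_trans (4 * (n1 * n2) * (x + y))); first by rewrite ltn_pmul2r; lia.
  by nia.
have : 2 * (q * c) * (x + y) < 4 * (x * y).
  by rewrite -(@ltn_pmul2r (n1 + n2)); [nia | lia].
have -> : 2 * (q * c) * (x + y) = 4 * q * q * (c * (a + b)) by rewrite /x /y; nia.
have -> : 4 * (x * y) = 4 * q * q * (4 * (a * b)) by rewrite /x /y; nia.
by rewrite ltn_pmul2l // !muln_gt0 q_gt0.
Qed.

Lemma decomposes_cross_class (X Y : finType) (f : X -> nat) (g : Y -> nat) :
  (forall c, c < 3 -> #|[pred x | f x == c]| = #|[pred y | g y == c]|) ->
  decomposes (fun x x' => cross_class (f x) (f x')) ->
  decomposes (fun y y' => cross_class (g y) (g y')).
Proof.
move=> eq_fg; apply: (@decomposes_types _ _ _ cross_class (fun c => c < 3) (enum X) (enum Y)).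
- exact: cross_class_lt3.
- exact: enum_uniq.
- exact: enum_uniq.
- by move=> x _; rewrite mem_enum.
- by move=> y _; rewrite mem_enum.
- by move=> c c3; rewrite !count_enum; apply: eq_fg.
Qed.

Lemma scheme_extend (q' r s t : nat) (a : nat -> 'I_q'.+1 -> nat) (apex : bool)
    (home : 'I_q'.+1 * 'I_q'.+1 -> nat -> 'I_q'.+1) (q := q'.+1) :
  (forall (c c' : nat) (g d : 'I_q), c < 3 -> c' < 3 -> c != c' ->
     \sum_(k : 'I_q * 'I_q) ((block k c == g) && (home k c' == d)) = 1) ->
  (forall c g, a c g <= 10) -> (apex -> ~~ odd q) ->
  (forall k : 'I_q * 'I_q,
     cell_decomposes [:: a 0 (home k 0); a 1 (home k 1); a 2 (home k 2)]
                     (apex && diagonal k)) ->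
  (forall c, c < 3 -> \sum_g a c g + apex = nth 0 [:: r; s; t] c) ->
  cycle_decomposable 5 (complete_tripartite r s t) ->
  cycle_decomposable 5 (complete_tripartite (r + 5 * q) (s + 5 * q) (t + 5 * q)).
Proof.
move=> block_home a_le apex_even cells sum_a dec_rst.
apply: decomposes_cycle_decomposable; first exact: complete_tripartite_irr.
apply: eq_decomposes (fun x y => _) _ => [x y|]; first by rewrite complete_tripartiteE.
have {}dec_rst := cycle_decomposable_decomposes (@complete_tripartite_sym _ _ _)
  (@complete_tripartite_irr _ _ _) dec_rst.
apply: decomposes_cross_class (decomposes_extend block_home a_le apex_even cells _) => [c c3|].
  rewrite (card_any_class apex a_le (Ordinal c3)) sum_a // card_tripartite_part //.
  by case: c c3 => [|[|[|//]]] _ /=; rewrite addnC.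
apply: decomposes_cross_class (eq_decomposes _ dec_rst) => [c c3|x y]; last first.
  by rewrite complete_tripartiteE.
by rewrite (card_old_class apex a_le (Ordinal c3)) sum_a // card_tripartite_part.
Qed.

Lemma round_bounds q h g : g < q -> h < q * (((h + g) %/ q).+1) /\
  (0 < (h + g) %/ q -> q * ((h + g) %/ q - 1) < h).
Proof.
move=> gq; have := divn_eq (h + g) q; have := @ltn_pmod (h + g) q.
move: (_ %/ _) (_ %% _) => m k; case: q gq => // q gq /(_ isT) kq e.
split; first by nia.
by case: m e => // m e _; rewrite subn1 /=; nia.
Qed.

Lemma mean_rounds (d q n1 n2 n3 a b c : nat) :
  0 < n1 -> 0 < n3 -> n1 < 2 * (q * a.+1) -> n2 < 2 * (q * b.+1) ->
  (0 < c - d -> 2 * (q * (c - d)) < n3) ->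
  n3 * (n1 + n2) <= 4 * (n1 * n2) -> mean d a b c.
Proof.
move=> n1_gt0 n3_gt0 lt1 lt2 lt3 le4; rewrite /mean.
have -> : a + b + 2 = a.+1 + b.+1 by lia.
apply: (harmonic_mean_lt n1_gt0 lt1 lt2 _ le4).
case: posnP lt3 => [->|_ lt3]; [by rewrite muln0 | exact: lt3].
Qed.

(** The three cases are distinguished by the parities of [r] and [q].  [lvl c g] is the
    number of pairs of old vertices of class [c] that receive the index [g]; it lies
    between the floor and the ceiling of [h c / q], and is the floor for [g = 0]. *)
Lemma extend_tripartite q' r s t (q := q'.+1) : 0 < r -> r <= s -> s <= t ->
  t <= 10 * q -> (odd r -> ~~ odd q -> t <= 5 * q) ->
  cycle_decomposable 5 (complete_tripartite r s t) ->
  cycle_decomposable 5 (complete_tripartite (r + 5 * q) (s + 5 * q) (t + 5 * q)).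
Proof.
move=> r0 rs st t10 t5 dec_rst.
have [s_odd t_odd le_t le_s le_r] := tripartite_necessary r0 (leq_trans r0 rs) dec_rst.
pose n c := nth 0 [:: r; s; t] c; pose o : nat := odd r; pose h c := (n c)./2.
have nE c : c < 3 -> n c = o + 2 * h c.
  by rewrite /h /n /o; case: c => [|[|[|//]]] _ /=; lia.
have n_gt0 c : c < 3 -> 0 < n c by rewrite /n; case: c => [|[|[|//]]] _ /=; lia.
have n_le c : n c <= t by rewrite /n; case: c => [|[|[|c]]] /=; rewrite ?nth_default //; lia.
pose lvl c (g : 'I_q) := (h c + g) %/ q.
have lvl_hi c (g : 'I_q) : c < 3 -> n c < 2 * (q * (lvl c g).+1).
  by move=> c3; have [] := round_bounds (h c) (ltn_ord g); rewrite nE // /o -/(lvl c g); lia.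
have lvl_lo c (g : 'I_q) : c < 3 -> 0 < lvl c g - 1 -> 2 * (q * (lvl c g - 1)) < n c.
  move=> c3 l1; have [_] := round_bounds (h c) (ltn_ord g); rewrite -/(lvl c g) nE //; lia.
have harm c1 c2 c3 : c1 < 3 -> c2 < 3 -> c3 < 3 -> uniq [:: c1; c2; c3] ->
    n c3 * (n c1 + n c2) <= 4 * (n c1 * n c2).
  by case: c1 => [|[|[|//]]] _; case: c2 => [|[|[|//]]] _; case: c3 => [|[|[|//]]] _ //= _;
    rewrite /n /=; lia.
have balanced_of d (g0 g1 g2 : 'I_q) : (forall c (g : 'I_q), c < 3 ->
      g \in [:: g0; g1; g2] -> 0 < lvl c g - d -> 2 * (q * (lvl c g - d)) < n c) ->
    balanced d (lvl 0 g0) (lvl 1 g1) (lvl 2 g2).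
  move=> lo; have m c1 c2 c3 g g' g'' : c1 < 3 -> c2 < 3 -> c3 < 3 ->
      uniq [:: c1; c2; c3] -> g'' \in [:: g0; g1; g2] ->
      mean d (lvl c1 g) (lvl c2 g') (lvl c3 g'').
    move=> c13 c23 c33 u g_in; apply: mean_rounds (harm _ _ _ c13 c23 c33 u).
    - exact: n_gt0.
    - exact: n_gt0.
    - exact: lvl_hi.
    - exact: lvl_hi.
    exact: lo.
  by apply/and3P; split; apply: m; rewrite // !inE eqxx ?orbT.
have bal1 (g0 g1 g2 : 'I_q) : balanced 1 (lvl 0 g0) (lvl 1 g1) (lvl 2 g2).
  by apply: balanced_of => c g c3 _; apply: lvl_lo.
have sum_lvl c : \sum_(g < q) 2 * lvl c g = 2 * h c.
  by rewrite -big_distrr /= sum_floor.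
have lvl5 c (g : 'I_q) : lvl c g < 6.
  rewrite /lvl ltn_divLR // /h; have := n_le c; have := ltn_ord g; lia.
have even_cell (g0 g1 g2 : 'I_q) :
    cell_decomposes [:: 2 * lvl 0 g0; 2 * lvl 1 g1; 2 * lvl 2 g2] false.
  rewrite -[2 * lvl 0 g0]addn0 -[2 * lvl 1 g1]addn0 -[2 * lvl 2 g2]addn0.
  by apply: (coversP covers_even).
(* Attachment by blocks, without apices. *)
case odd_r : (odd r); last first.
  apply: (@scheme_extend q' r s t (fun c g => 2 * lvl c g) false (@block q')) => //.
  - by move=> c c' g d; apply: block_pair.
  - by move=> c g; have := lvl5 c g; lia.
  by move=> c c3; rewrite sum_lvl addn0 -[RHS]/(n c) nE // /o odd_r.
(* Attachment by blocks, with one apex in each class. *)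
case odd_q : (odd q); last first.
  apply: (@scheme_extend q' r s t (fun c g => 2 * lvl c g) true (@block q')) => //.
  - by move=> c c' g d; apply: block_pair.
  - by move=> c g; have := lvl5 c g; lia.
  - by rewrite odd_q.
  - move=> k; case: (diagonal k) => //=.
    rewrite -[2 * lvl 0 _]addn0 -[2 * lvl 1 _]addn0 -[2 * lvl 2 _]addn0.
    have lvl3 c (g : 'I_q) : c < 3 -> lvl c g < 4.
      move=> c3; rewrite /lvl ltn_divLR // /h; have := n_le c; have := ltn_ord g.
      have := t5 odd_r (negbT odd_q); have := nE _ c3; rewrite /h /o odd_r; lia.
    by apply: (coversP covers_apex) => //; apply: lvl3.
  by move=> c c3; rewrite sum_lvl -[RHS]/(n c) nE // /o odd_r addnC.
(* Attachment by slope.  The index 0 takes the odd vertex because it receives the fewest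
   pairs; elsewhere it could exceed the bound 10. *)
have lvl0 c : c < 3 -> lvl c ord0 < 5.
  move=> c3; rewrite /lvl addn0 ltn_divLR // /h; have := n_le c.
  have := nE _ c3; rewrite /h /o odd_r; lia.
apply: (@scheme_extend q' r s t
  (fun c g => if c < 3 then 2 * lvl c g + (g == ord0) else 0) false
  (fun k _ => slope k)) => //.
- by move=> c c' g d c3 _ _; apply: block_slope.
- move=> c g; case: ifP => // c3; have := lvl5 c g; case: eqP => [->|_]; last by lia.
  by have := lvl0 c c3; lia.
- move=> k /=; case: (slope k =P ord0) => [->|_]; last by rewrite !addn0.
  apply: (coversP covers_odd); rewrite ?lvl0 //; apply: balanced_of => c g c3.
  rewrite !inE !orbb => /eqP-> _; rewrite subn0 nE // /o odd_r /lvl addn0.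
  by rewrite add1n ltnS leq_mul2l mulnC leq_trunc_div.
move=> c c3; under eq_bigr do rewrite c3.
rewrite big_split /= sum_lvl (@sum_pred1 _ _ ord0) // addn0.
by rewrite -[RHS]/(n c) nE // /o odd_r addnC.
Qed.

Theorem corollary4p3 (r s t : nat)
  (r_gt0 : 0 < r) (le_rs : r <= s) (le_st : s <= t)
  (dec_rst : cycle_decomposable 5 (complete_tripartite r s t))
  (p : nat) (p_gt0 : 0 < p) (p_dvd5 : 5 %| p) (p_mod2 : p = r %[mod 2])
  (le_tp : t <= 2 * p) (le_pr : p <= 3 * r)
  (n : nat) (n_gt0 : 0 < n) :
  cycle_decomposable 5
    (complete_tripartite (r + n * p) (s + n * p) (t + n * p)).
Proof.
have /dvdnP[m p_eq] := p_dvd5.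
have q_gt0 : 0 < n * m by rewrite muln_gt0 n_gt0; lia.
have np_eq : n * p = 5 * (n * m).-1.+1 by rewrite prednK // p_eq; lia.
rewrite np_eq; apply: extend_tripartite => //; rewrite prednK //.
  by apply: leq_trans le_tp _; rewrite p_eq; nia.
move=> odd_r; rewrite oddM negb_and => even_q.
have odd_m : odd m by move: p_mod2; rewrite p_eq !modn2 oddM odd_r andbT; case: odd.
have n2 : 2 <= n by case/orP: even_q; [lia | rewrite odd_m].
by apply: leq_trans le_tp _; rewrite p_eq; nia.
Qed.
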